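(* Let $G_m$ be a bounded Vilenkin group and let $f\in L_1(G_m\times G_m)$. Then $$\lim_{n\to\infty}\sigma_n(x,y;f)=f(x,y)$$ for every Marcinkiewicz-Lebesgue point $(x,y)\in G_m\times G_m$ of $f$.
   Context: Let $\mathbb N=\{0,1,2,\dots\}$ and let $m=(m_0,m_1,\dots)$ be a bounded sequence of integers $m_k\ge 2$. $Z_{m_k}=\{0,1,\dots,m_k-1\}$ is the additive group of integers modulo $m_k$, and $G_m=\prod_{k} Z_{m_k}$ is the complete direct product (product of discrete topologies), with coordinatewise addition modulo $m_k$ (the inverse operation is denoted $-$), elements $x=(x_0,x_1,\dots)$, $x_k\in Z_{m_k}$. Since $m$ is bounded, $G_m$ is called a bounded Vilenkin group. $\mu$ is the normalized Haar measure (the product of the uniform probability measures on $Z_{m_k}$); the product measure on $G_m\times G_m$ is also denoted $\mu$. Put $I_0(x)=G_m$, $I_n(x)=\{y\in G_m: y_0=x_0,\dots,y_{n-1}=x_{n-1}\}$, $I_n=I_n(0)$. Let $e_n\in G_m$ have $n$-th coordinate $1$ and all other coordinates $0$; for an integer $a$ with $0\le a\le m_n-1$, $a e_n$ is the element with $n$-th coordinate $a$ and other coordinates $0$. Let $M_0=1$, $M_{k+1}=m_kM_k$. Every $n\in\mathbb N$ is uniquely $n=\sum_{j\ge0} n_jM_j$ with $n_j\in Z_{m_j}$. Vilenkin functions: $r_k(x)=\exp(2\pi \imath x_k/m_k)$ with $\imath^2=-1$, and $\psi_n(x)=\prod_{k\ge0} r_k(x)^{n_k}$. Fourier coefficients,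 partial sums and Marcinkiewicz-Fejér means of $f\in L_1(G_m\times G_m)$: $\widehat f(i,j)=\int_{G_m\times G_m} f(x,y)\overline{\psi_i(x)}\,\overline{\psi_j(y)}\,d\mu(x,y)$, $$S_{M,N}(x,y;f)=\sum_{i=0}^{M-1}\sum_{j=0}^{N-1}\widehat f(i,j)\psi_i(x)\psi_j(y),\qquad \sigma_n(x,y;f)=\frac1n\sum_{j=0}^{n-1}S_{j,j}(x,y;f)\quad(n\ge1).$$ For $i\le n$ let $r_{i,n}(x,y)=\prod_{l=i}^{n}\Big(\sum_{s=0}^{m_l-1}\psi_{M_l}(x+y)^s\Big)$, which equals $m_im_{i+1}\cdots m_n$ if $x_l+y_l\equiv 0 \pmod{m_l}$ for all $l=i,\dots,n$, and $0$ otherwise; an empty product ($i>n$) equals $1$. For $j\in\mathbb N$ define, with $\Delta(t,u)=|f(x-t,y-u)-f(x,y)|$, $$\begin{aligned}W_j(x,y;f)=\;&M_j^{-1}\sum_{q=0}^{j-1}\sum_{k=q}^{j-1}\sum_{a=1}^{m_q-1}M_qM_k^2\int_{I_k\times I_k(a e_q)}\Delta(t,u)\,r_{k+1,j-1}(t,u)\,d\mu(t,u)\\&+M_j^{-1}\sum_{q=0}^{j-1}\sum_{k=q}^{j-1}\sum_{a=1}^{m_q-1}M_qM_k^2\int_{I_k(a e_q)\times I_k}\Delta(t,u)\,r_{k+1,j-1}(t,u)\,d\mu(t,u)\\&+\sum_{s=0}^{j}\sum_{i=s}^{j}M_sM_i\sum_{a=1}^{m_s-1}\int_{I_j\times I_i(a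 e_s)}\Delta(t,u)\,d\mu(t,u)\\&+\sum_{s=0}^{j}\sum_{i=s}^{j}M_sM_i\sum_{a=1}^{m_s-1}\int_{I_i(a e_s)\times I_j}\Delta(t,u)\,d\mu(t,u).\end{aligned}$$ A point $(x,y)\in G_m\times G_m$ is a Marcinkiewicz-Lebesgue point of $f\in L_1(G_m\times G_m)$ if $\lim_{n\to\infty}W_n(x,y;f)=0$. *)

(* Defs.v *)
From HB Require Import structures.
From mathcomp Require Import all_boot all_order all_algebra.
From mathcomp Require Import complex.
From mathcomp Require Import all_classical all_reals all_analysis.

Set Implicit Arguments.
Unset Strict Implicit.
Unset Printing Implicit Defensive.
Import Order.TTheory GRing.Theory Num.Theory.
Import numFieldNormedType.Exports.

Local Open Scope classical_set_scope.
Local Open Scope ring_scope.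
Local Open Scope complex_scope.

(* 'Z_n is the ring of integers modulo n only for n >= 2, so this type is the
   intended group only under the hypothesis [forall k, (2 <= m k)%N]. *)
Definition vilenkin (m : nat -> nat) : Type := forall k : nat, 'Z_(m k).

Section VilenkinGroup.
Variable m : nat -> nat.

HB.instance Definition _ := Choice.copy (vilenkin m) (forall k, 'Z_(m k)).

Definition vadd (x y : vilenkin m) : vilenkin m := fun k => x k + y k.
Definition vopp (x : vilenkin m) : vilenkin m := fun k => - x k.
Definition vzero : vilenkin m := fun=> 0.

Lemma vaddA : associative vadd.
Proof. by move=> x y z; apply: functional_extensionality_dep => k; exact: addrA. Qed.

Lemma vaddC : commutative vadd.
Proof. by move=> x y; apply: functional_extensionality_dep => k; exact: addrC. Qed.

Lemma vadd0 : left_id vzero vadd.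
Proof. by move=> x; apply: functional_extensionality_dep => k; exact: add0r. Qed.

Lemma vaddN : left_inverse vzero vopp vadd.
Proof. by move=> x; apply: functional_extensionality_dep => k; exact: addNr. Qed.

HB.instance Definition _ :=
  GRing.isZmodule.Build (vilenkin m) vaddA vaddC vadd0 vaddN.
HB.instance Definition _ := isPointed.Build (vilenkin m) vzero.

(* Generators of the product of the discrete sigma-algebras; since the factors
   are finite and countably many, this is also the Borel sigma-algebra of the
   product topology. *)
Definition coordinate_sets : set (set (vilenkin m)) :=
  [set A | exists (k : nat) (a : 'Z_(m k)), A = [set x | x k = a]].

HB.instance Definition _ := @isMeasurable.Build (sigma_display coordinate_sets)
  (vilenkin m) <<s coordinate_sets >> (@sigma_algebra0 _ setT coordinate_sets)
  (@sigma_algebraC _ coordinate_sets)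
  (@sigma_algebra_bigcup _ setT coordinate_sets).

Definition Icyl (n : nat) (x : vilenkin m) : set (vilenkin m) :=
  [set y | forall k, (k < n)%N -> y k = x k].

(* a e_n *)
Definition mul_e (a n : nat) : vilenkin m :=
  fun k => if k == n then a%:R else 0.

Definition Mprod (k : nat) : nat := (\prod_(i < k) m i)%N.

Definition digit (n k : nat) : nat := ((n %/ Mprod k) %% m k)%N.

Variable R : realType.

(* The normalized Haar measure, as the product of the uniform probability
   measures on the factors; on this sigma-algebra the condition determines mu. *)
Definition is_haar (mu : probability (vilenkin m) R) : Prop :=
  forall (n : nat) (A : forall k : nat, {set 'Z_(m k)}),
    mu [set x | forall k, (k < n)%N -> x k \in A k] =
    (\prod_(k < n) (#|A k|%:R / (m k)%:R))%:E.

Definition cexpi (t : R) : R[i] := cos t +i* sin t.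

Definition rademacher (k : nat) (x : vilenkin m) : R[i] :=
  cexpi (2 * pi * (x k : nat)%:R / (m k)%:R).

(* As all m k >= 2, the digits of n of index k >= n vanish, so the finite
   product is the product over all k. *)
Definition psi (n : nat) (x : vilenkin m) : R[i] :=
  \prod_(k < n) rademacher k x ^+ digit n k.

Definition rprod (i n : nat) (x y : vilenkin m) : R[i] :=
  \prod_(i <= l < n.+1) \sum_(s < m l) psi (Mprod l) (x + y) ^+ s.

End VilenkinGroup.

Section ComplexIntegral.
Context d (T : measurableType d) (R : realType).
Variable nu : {measure set T -> \bar R}.

Definition Cintegrable (f : T -> R[i]) : Prop :=
  nu.-integrable setT (fun z => (complex.Re (f z))%:E) /\
  nu.-integrable setT (fun z => (complex.Im (f z))%:E).

Definition Cintegral (D : set T) (f : T -> R[i]) : R[i] :=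
  Rintegral nu D (fun z => complex.Re (f z)) +i*
  Rintegral nu D (fun z => complex.Im (f z)).

End ComplexIntegral.

Section MarcinkiewiczFejer.
Variables (R : realType) (m : nat -> nat) (mu : probability (vilenkin m) R).
Variable f : vilenkin m * vilenkin m -> R[i].

Let mu2 := (mu \x mu)%E.
Let M (k : nat) : R[i] := (Mprod m k)%:R.

Definition fourier_coef (i j : nat) : R[i] :=
  Cintegral mu2 setT
    (fun z => f z * (psi R i z.1)^* * (psi R j z.2)^*).

Definition partial_sum (K L : nat) (x y : vilenkin m) : R[i] :=
  \sum_(i < K) \sum_(j < L) fourier_coef i j * psi R i x * psi R j y.

Definition marcinkiewicz_fejer (n : nat) (x y : vilenkin m) : R[i] :=
  n%:R^-1 * \sum_(j < n) partial_sum j j x y.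

Definition Delta (x y t u : vilenkin m) : R[i] :=
  `|f (x - t, y - u) - f (x, y)|.

Definition Wmean (j : nat) (x y : vilenkin m) : R[i] :=
  (M j)^-1 *
    (\sum_(0 <= q < j) \sum_(q <= k < j) \sum_(1 <= a < m q)
       M q * M k ^+ 2 *
       Cintegral mu2 (Icyl k 0 `*` Icyl k (mul_e m a q))
         (fun z => Delta x y z.1 z.2 * rprod R k.+1 j.-1 z.1 z.2))
  + (M j)^-1 *
    (\sum_(0 <= q < j) \sum_(q <= k < j) \sum_(1 <= a < m q)
       M q * M k ^+ 2 *
       Cintegral mu2 (Icyl k (mul_e m a q) `*` Icyl k 0)
         (fun z => Delta x y z.1 z.2 * rprod R k.+1 j.-1 z.1 z.2))
  + \sum_(0 <= s < j.+1) \sum_(s <= i < j.+1)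
      M s * M i * \sum_(1 <= a < m s)
        Cintegral mu2 (Icyl j 0 `*` Icyl i (mul_e m a s))
          (fun z => Delta x y z.1 z.2)
  + \sum_(0 <= s < j.+1) \sum_(s <= i < j.+1)
      M s * M i * \sum_(1 <= a < m s)
        Cintegral mu2 (Icyl i (mul_e m a s) `*` Icyl j 0)
          (fun z => Delta x y z.1 z.2).

(* R[i]^o is R[i] with the topology of its complex modulus. *)
Definition marcinkiewicz_lebesgue_point (x y : vilenkin m) : Prop :=
  ((fun n => Wmean n x y : R[i]^o) @ \oo --> (0 : R[i]^o)).

End MarcinkiewiczFejer.

(* Main.v *)
Require Import Defs.
From HB Require Import structures.
From mathcomp Require Import all_boot all_order all_algebra.
From mathcomp Require Import complex.
From mathcomp Require Import all_classical all_reals all_analysis.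
From mathcomp Require Import measurable_realfun zify ring.
Import Order.TTheory GRing.Theory Num.Theory.
Import numFieldNormedType.Exports.
Local Open Scope classical_set_scope.
Local Open Scope ring_scope.
Local Open Scope complex_scope.

(** The proof compares the Marcinkiewicz kernel with the kernel of W pointwise,
    before any integration.  Let D_n be the Dirichlet kernel,
    G_n = sum_{l<n} D_l and K_n (t, u) = sum_{l<n} D_l (t) D_l (u).  Since
    psi_{h M_A + l} = psi_{h M_A} psi_l for l < M_A, all of them satisfy a shift
    formula; for D it reads D_{h M_A + l} = D_{h M_A} + psi_{h M_A} D_l.

    Cutting M_{A+1} into m_A blocks of length M_A gives
    K_{M_{A+1}} = cross terms + (sum_{r<m_A} r_A (t + u)^r) K_{M_A}.
    The sum in front of K_{M_A} is the A-th factor of the product r_{i,n} in the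
    definition of W, and the cross terms are products of D_{r M_A}, which lives
    on the subgroup I_A, with D_{r M_A} or G_{M_A}.  The same cutting shows that
    G_{M_A} is at most a constant times M_A sum_{s<=A} M_s 1_{I_A (a e_s)},
    summed over a (norm_fejer_sum_M).  Unrolling the recursion reproduces the
    first two parts of M_A W_A (norm_marcinkiewicz_sum_M).  For arbitrary n, peel
    off the leading digit: the mixed terms D_{b M_N} (t) G_l (u) have the shape
    of the last two parts of W.  The outcome is
    |K_n| <= C sum_{A<=N} w_A for n < M_{N+1}, where w_A >= 0 is the kernel of
    M_A W_A (norm_marcinkiewicz_sum_le, Delta_int_W_kernel).

    Reflections t |-> x - t preserve Haar measure (haar_reflect), which yields
    both the orthogonality of the characters and the convolution formula
    sum_{l<n} S_{l,l} f = int f (x - t, y - u) K_n (t, u).  As int K_n = n - 1,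
    n sigma_n - (n - 1) f (x, y) is bounded by a constant times
    sum_{A<=N} M_A W_A.  When M_N <= n < M_{N+1}, division by n turns this into a
    weighted mean whose weights M_A / n grow geometrically in A, so that it tends
    to 0 together with W_A. *)

Set Implicit Arguments.
Unset Strict Implicit.
Unset Printing Implicit Defensive.

(** * Mixed radix digits *)

Section MixedRadix.
Variable m : nat -> nat.
Hypothesis m_ge2 : forall k, (2 <= m k)%N.
Local Notation M := (Mprod m).

Lemma Mprod0 : M 0 = 1%N.
Proof. by rewrite /Mprod big_ord0. Qed.

Lemma MprodS k : M k.+1 = (m k * M k)%N.
Proof. by rewrite /Mprod big_ord_recr mulnC. Qed.

Lemma Mprod_gt0 k : (0 < M k)%N.
Proof.
elim: k => [|k IH]; first by rewrite Mprod0.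
by rewrite MprodS muln_gt0 IH andbT (ltn_trans _ (m_ge2 k)).
Qed.

Lemma leq_double_Mprod k : ((M k).*2 <= M k.+1)%N.
Proof. by rewrite MprodS -mul2n leq_mul2r m_ge2 orbT. Qed.

Lemma ltn_Mprod k : (k < M k)%N.
Proof.
elim: k => [|k IH]; first by rewrite Mprod0.
by have := leq_double_Mprod k; lia.
Qed.

Lemma dvdn_Mprod j k : (j <= k)%N -> (M j %| M k)%N.
Proof.
move=> /subnK <-; elim: (k - j)%N => [|i IH]; first by rewrite dvdnn.
by rewrite addSn MprodS dvdn_mull.
Qed.

Lemma leq_Mprod j k : (j <= k)%N -> (M j <= M k)%N.
Proof. by move=> jk; rewrite dvdn_leq ?Mprod_gt0 ?dvdn_Mprod. Qed.

Lemma digit_small n k : (n < M k)%N -> digit m n k = 0%N.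
Proof. by move=> nk; rewrite /digit divn_small// mod0n. Qed.

Lemma digit_low A h l k : (k < A)%N ->
  digit m (h * M A + l) k = digit m l k.
Proof.
move=> kA; have /dvdnP[c MA] := dvdn_Mprod kA.
rewrite /digit MA MprodS !mulnA divnMDl ?Mprod_gt0//.
by rewrite modnMDl.
Qed.

Lemma digit_high A h l k : (A <= k)%N -> (l < M A)%N ->
  digit m (h * M A + l) k = digit m (h * M A) k.
Proof.
move=> Ak lA; have /dvdnP[c Mk] := dvdn_Mprod Ak.
rewrite /digit Mk [(c * _)%N]mulnC !divnMA mulnK ?Mprod_gt0//.
by rewrite divnMDl ?Mprod_gt0// (divn_small lA) addn0.
Qed.

(** Adding l < M_A to a multiple of M_A creates no carry: the multiple only has
    digits of index at least A, and l only digits of smaller index. *)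
Lemma digit_add A h l k : (l < M A)%N ->
  digit m (h * M A + l) k = (digit m (h * M A) k + digit m l k)%N.
Proof.
move=> lA; have [kA|Ak] := ltnP k A.
  rewrite digit_low// -[in X in (X + _)%N](addn0 (h * M A)%N) digit_low//.
  by rewrite [digit m 0 k]digit_small ?Mprod_gt0.
by rewrite digit_high// (@digit_small l) ?addn0// (leq_trans lA)// leq_Mprod.
Qed.

Lemma digit_mulM A r k : (r < m A)%N ->
  digit m (r * M A) k = if k == A then r else 0%N.
Proof.
move=> rA; case: (ltngtP k A) => [kA|Ak|->].
- by rewrite -(addn0 (r * M A)%N) digit_low// digit_small ?Mprod_gt0.
- rewrite digit_small// (@leq_trans (M A.+1)) ?leq_Mprod//.
  by rewrite MprodS ltn_mul2r Mprod_gt0.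
- by rewrite /digit mulnK ?Mprod_gt0// modn_small.
Qed.

Lemma leading_digit n N : (n < M N.+1)%N ->
  exists b l, [/\ (b < m N)%N, (l < M N)%N & n = (b * M N + l)%N].
Proof.
move=> nN; exists (n %/ M N)%N, (n %% M N)%N; split.
- by rewrite ltn_divLR ?Mprod_gt0// -MprodS.
- by rewrite ltn_pmod ?Mprod_gt0.
- exact: divn_eq.
Qed.

Lemma Mprod_bracket n : (0 < n)%N -> exists2 N, (M N <= n)%N & (n < M N.+1)%N.
Proof.
move=> n0; have ex : exists N, (n < M N)%N by exists n; apply: ltn_Mprod.
case: (ex_minnP ex) => -[|N] nN Nmin.
  by move: nN; rewrite Mprod0 ltnNge n0.
by exists N => //; rewrite leqNgt; apply/negP => /Nmin; rewrite ltnn.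
Qed.

Lemma sum_Mprod_le A : (\sum_(s < A.+1) M s <= 2 * M A)%N.
Proof.
elim: A => [|A IH]; first by rewrite big_ord_recr big_ord0/= Mprod0.
rewrite big_ord_recr/=; apply: leq_trans (leq_add IH (leqnn _)) _.
by have := leq_double_Mprod A; lia.
Qed.

End MixedRadix.

(** * The Vilenkin characters *)

Section UnitCircle.
Variable R : realType.

Lemma cexpiD (s t : R) : cexpi (s + t) = cexpi s * cexpi t.
Proof.
rewrite /cexpi cosD sinD; apply/eqP; rewrite eq_complex/= eqxx/= addrC.
by rewrite [X in _ == X + _]mulrC mulrC [X in _ + X]mulrC.
Qed.

Lemma cexpi0 : cexpi (0 : R) = 1.
Proof. by rewrite /cexpi cos0 sin0. Qed.

Lemma cexpi_nat (t : R) n : cexpi (n%:R * t) = cexpi t ^+ n.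
Proof.
elim: n => [|n IH]; first by rewrite mul0r cexpi0.
by rewrite exprS -IH -cexpiD -natr1 mulrDl mul1r addrC.
Qed.

Lemma norm_cexpi (t : R) : `|cexpi t| = 1.
Proof. by rewrite normc_def/= cos2Dsin2 sqrtr1. Qed.

Lemma cexpi2pi : cexpi (2 * pi : R) = 1.
Proof. by rewrite /cexpi mulr_natl cos2pi sin2pi. Qed.

Lemma cexpi_neq1 (t : R) : 0 < t -> t < 2 * pi -> cexpi t != 1.
Proof.
move=> t0 t2; apply/eqP => -[c _].
have s0 : 0 < sin (t / 2).
  apply: sin_gt0_pi; rewrite divr_gt0//=.
  by rewrite ltr_pdivrMr// mulrC.
have : cos t < 1.
  rewrite [t]splitr cosD -!expr2 cos2sin2.
  have := exprn_gt0 2 s0; set a := _ ^+ 2 => a0.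
  by rewrite -addrA gtrDl -opprD oppr_lt0 addr_gt0.
by rewrite c ltxx.
Qed.

End UnitCircle.

Section Characters.
Variables (R : realType) (m : nat -> nat).
Hypothesis m_ge2 : forall k, (2 <= m k)%N.
Local Notation M := (Mprod m).
Local Notation V := (vilenkin m).
Local Notation rad := (@rademacher m R).
Local Notation psi := (@psi m R).

Lemma ltn_Zm k (a : 'Z_(m k)) : (a < m k)%N.
Proof. by rewrite (leq_trans (ltn_ord a))// Zp_cast. Qed.

Lemma Zm_gt0 k : (0 < m k)%N.
Proof. exact: ltn_trans (m_ge2 k). Qed.

Lemma rademacherE k (x : V) : rad k x = cexpi (2 * pi / (m k)%:R) ^+ (x k).
Proof.
by rewrite -cexpi_nat /rademacher; congr cexpi; rewrite [RHS]mulrC mulrAC.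
Qed.

Lemma cexpi_root k : cexpi (2 * pi / (m k)%:R : R) ^+ m k = 1.
Proof.
rewrite -cexpi_nat mulrC divfK ?cexpi2pi// pnatr_eq0 -lt0n.
exact: Zm_gt0.
Qed.

Lemma rademacherD k (x y : V) : rad k (x + y) = rad k x * rad k y.
Proof.
rewrite !rademacherE -exprD.
have -> : ((x + y)%R k : nat) = ((x k + y k)%N %% m k)%N.
  exact: (congr1 (modn (x k + y k)%N) (Zp_cast (m_ge2 k))).
rewrite [in RHS](divn_eq (x k + y k) (m k)) exprD mulnC exprM cexpi_root.
by rewrite expr1n mul1r.
Qed.

Lemma rademacher_root k (x : V) : rad k x ^+ m k = 1.
Proof. by rewrite rademacherE -exprM mulnC exprM cexpi_root expr1n. Qed.

Lemma norm_rademacher k (x : V) : `|rad k x| = 1.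
Proof. exact: norm_cexpi. Qed.

Lemma rademacher_eq1 k (x : V) : (rad k x == 1) = (x k == 0).
Proof.
apply/eqP/eqP => [|x0]; last by rewrite rademacherE x0 expr0.
apply: contraPP => x0; apply/eqP.
have xk0 : (0 < x k)%N.
  by rewrite lt0n; apply/eqP => H; apply: x0; apply: val_inj.
have mk0 : (0 : R) < (m k)%:R by rewrite ltr0n Zm_gt0.
apply: cexpi_neq1; first by rewrite divr_gt0// !mulr_gt0 ?pi_gt0// ltr0n.
by rewrite ltr_pdivrMr// ltr_pM2l ?mulr_gt0 ?pi_gt0// ltr_nat ltn_Zm.
Qed.

(** Orthogonality on one cyclic factor: the geometric sum of an m_k-th root of
    unity vanishes unless the root is 1, that is, unless x_k = 0. *)
Lemma sum_rademacher k (x : V) :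
  \sum_(s < m k) rad k x ^+ s = (m k)%:R * (x k == 0)%:R.
Proof.
have [x0|x0] := eqVneq (x k) 0.
  under eq_bigr => s _ do rewrite rademacherE x0 expr0 expr1n.
  by rewrite sumr_const card_ord mulr1.
have r1 : rad k x - 1 != 0 by rewrite subr_eq0 rademacher_eq1.
apply: (mulfI r1); rewrite -subrX1 rademacher_root subrr mulr0.
by rewrite mulr0.
Qed.

(** Since n < M_n, digits of index n and beyond vanish, so the product that
    defines psi may be extended to any common range. *)
Lemma psi_widen n K (x : V) : (n <= K)%N ->
  psi n x = \prod_(k < K) rad k x ^+ digit m n k.
Proof.
move=> nK; rewrite /psi.
rewrite (big_ord_widen_cond K predT (fun k => rad k x ^+ digit m n k))//.
rewrite big_mkcond; apply: eq_bigr => k _ /=; case: ifPn => //.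
rewrite -leqNgt => nk.
by rewrite digit_small ?expr0// (leq_ltn_trans nk)// ltn_Mprod.
Qed.

Lemma psi0 (x : V) : psi 0 x = 1.
Proof. by rewrite /psi big_ord0. Qed.

Lemma psi_shift A h l (x : V) : (l < M A)%N ->
  psi (h * M A + l) x = psi (h * M A) x * psi l x.
Proof.
move=> lA; rewrite (psi_widen _ (leqnn _)).
rewrite (psi_widen _ (leq_addr l _)) (psi_widen _ (leq_addl (h * M A) l)).
by rewrite -big_split; apply: eq_bigr => k _; rewrite digit_add// exprD.
Qed.

Lemma psi_mulM A r (x : V) : (r < m A)%N -> psi (r * M A) x = rad A x ^+ r.
Proof.
move=> rA; have := leq_maxl (r * M A)%N A.+1; have := leq_maxr (r * M A)%N A.+1.
set K := maxn _ _ => AK rK; rewrite (psi_widen _ rK).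
rewrite (bigD1 (Ordinal AK))//= digit_mulM// eqxx.
rewrite big1 ?mulr1// => k kA; rewrite digit_mulM//.
by have -> : (k == A :> nat) = false by apply/negbTE.
Qed.

Lemma psi_M A (x : V) : psi (M A) x = rad A x.
Proof. by rewrite -[X in psi X](mul1n) psi_mulM. Qed.

Lemma psiD n (x y : V) : psi n (x + y) = psi n x * psi n y.
Proof.
by rewrite /psi -big_split; apply: eq_bigr => k _; rewrite rademacherD exprMn.
Qed.

Lemma norm_psi n (x : V) : `|psi n x| = 1.
Proof.
by rewrite /psi normr_prod big1// => k _; rewrite normrX norm_rademacher expr1n.
Qed.

Lemma psi_at0 n : psi n (0 : V) = 1.
Proof. by rewrite /psi big1// => k _; rewrite rademacherE expr0 expr1n. Qed.

Lemma psi_conj n (x : V) : ((psi n x)^*)%R = psi n (- x).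
Proof.
have p0 : psi n x != 0 by rewrite -normr_eq0 norm_psi oner_eq0.
apply: (mulfI p0); rewrite -psiD subrr psi_at0.
by rewrite -normCK norm_psi expr1n.
Qed.

(** For n > 0 the leading digit of n, say of index N, is nonzero, and psi_n
    takes at e_N the value exp (2 pi i d / m_N) with 0 < d < m_N. *)
Lemma psi_neq1 n : (0 < n)%N -> exists x : V, psi n x != 1.
Proof.
move=> n0.
have [N nN Nn] := Mprod_bracket m_ge2 n0.
(* the point e_N, at which only the digit of index N matters *)
exists (fun k => if k == N then 1 else 0).
set x := (fun k => _) : V.
have NK : (N < n)%N by rewrite (leq_trans (ltn_Mprod m_ge2 N)).
rewrite /psi (bigD1 (Ordinal NK))//= big1 ?mulr1; last first.
  move=> k kN; have /negbTE kN' : k != N :> nat by [].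
  by rewrite rademacherE /x kN' expr0 expr1n.
have d0 : (0 < digit m n N < m N)%N.
  rewrite /digit ltn_pmod ?Zm_gt0// andbT modn_small ?divn_gt0 ?Mprod_gt0//.
  by rewrite ltn_divLR ?Mprod_gt0// -MprodS.
rewrite -psi_mulM ?(andP d0).2//.
have x1 : (x N : nat) = 1%N by rewrite /x eqxx/= Zp_cast// modn_small.
rewrite psi_mulM ?(andP d0).2// rademacherE x1 expr1 -cexpi_nat.
have mk0 : (0 : R) < (m N)%:R by rewrite ltr0n Zm_gt0.
case/andP: d0 => d0 d1; apply: cexpi_neq1.
  by rewrite mulr_gt0 ?ltr0n// divr_gt0// mulr_gt0 ?pi_gt0.
rewrite mulrA ltr_pdivrMr// mulrC ltr_pM2l ?mulr_gt0 ?pi_gt0//.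
by rewrite ltr_nat.
Qed.

Lemma rprodE i n (x y : V) :
  rprod R i n x y = \prod_(i <= l < n.+1) ((m l)%:R * (x l + y l == 0)%:R).
Proof.
rewrite /rprod; apply: eq_bigr => l _.
by under eq_bigr => s _ do rewrite psi_M; rewrite sum_rademacher.
Qed.

End Characters.

(** * Dirichlet, Fejer and Marcinkiewicz kernels *)

Section Kernels.
Variables (R : realType) (m : nat -> nat).
Hypothesis m_ge2 : forall k, (2 <= m k)%N.
Local Notation M := (Mprod m).
Local Notation V := (vilenkin m).
Local Notation psi := (@psi m R).

(** The sums are left unnormalised: the Marcinkiewicz kernel of order n is
    marcinkiewicz_sum n divided by n, which keeps the recursions below free of
    denominators. *)
Definition dirichlet n (t : V) : R[i] := \sum_(i < n) psi i t.
Definition fejer_sum n (t : V) : R[i] := \sum_(l < n) dirichlet l t.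
Definition marcinkiewicz_sum n (t u : V) : R[i] :=
  \sum_(l < n) dirichlet l t * dirichlet l u.
Local Notation D := dirichlet.
Local Notation G := fejer_sum.
Local Notation K := marcinkiewicz_sum.

(** The shift formula on which every kernel recursion rests: past a multiple
    h M_A, a stretch of at most M_A indices repeats the initial one up to the
    unimodular factor psi_{h M_A}. *)
Lemma dirichlet_shift A h l t : (l <= M A)%N ->
  D (h * M A + l) t = D (h * M A) t + psi (h * M A) t * D l t.
Proof.
move=> lA; rewrite /D big_split_ord/=; congr (_ + _); rewrite mulr_sumr.
by apply: eq_bigr => i _; rewrite psi_shift// (leq_trans (ltn_ord i)).
Qed.

Lemma fejer_sum_shift A h l t : (l <= M A)%N ->
  G (h * M A + l) t =
  G (h * M A) t + l%:R * D (h * M A) t + psi (h * M A) t * G l t.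
Proof.
move=> lA; rewrite /G big_split_ord/= -addrA; congr (_ + _).
under eq_bigr => i _ do
  rewrite dirichlet_shift ?(leq_trans (ltnW (ltn_ord i)))//.
by rewrite big_split/= sumr_const card_ord mulr_natl -mulr_sumr.
Qed.

(** Expanding the product of two instances of the shift formula, the two
    unimodular factors of the last term combine into psi_{h M_A} (t + u); this
    is where the sum t + u of the variables enters. *)
Lemma marcinkiewicz_sum_shift A h l t u : (l <= M A)%N ->
  K (h * M A + l) t u =
  K (h * M A) t u + l%:R * (D (h * M A) t * D (h * M A) u)
  + (D (h * M A) t * (psi (h * M A) u * G l u)
     + psi (h * M A) t * G l t * D (h * M A) u)
  + psi (h * M A) (t + u) * K l t u.
Proof.
move=> lA; rewrite /K big_split_ord/= -!addrA; congr (_ + _).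
rewrite (eq_bigr (fun i : 'I_l => D (h * M A) t * D (h * M A) u
  + (D (h * M A) t * (psi (h * M A) u * D i u)
     + psi (h * M A) t * D i t * D (h * M A) u)
  + psi (h * M A) (t + u) * (D i t * D i u))); last first.
  move=> i _; rewrite !dirichlet_shift ?(leq_trans (ltnW (ltn_ord i)))//.
  rewrite psiD//; move: (D _ t) (D _ u) (D i t) (D i u) (psi _ t) (psi _ u).
  by move=> a b c d p q; ring.
rewrite !big_split/= sumr_const card_ord mulr_natl -!mulr_sumr -mulr_suml.
by rewrite -mulr_sumr !addrA.
Qed.

Lemma indic_IcylS A (c t : V) :
  \1_(Icyl A.+1 c) t = \1_(Icyl A c) t * (t A == c A)%:R :> R[i].
Proof.
rewrite !indicE -natrM mulnb; congr (_%:R); congr nat_of_bool.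
apply/idP/andP => [/set_mem H|[/set_mem H /eqP tA]].
  by split; [apply/mem_set => k kA; apply: H; rewrite (ltn_trans kA)|rewrite H].
apply/mem_set => k; rewrite ltnS leq_eqVlt => /orP[/eqP ->//|]; exact: H.
Qed.

Lemma indic_Icyl0 (c t : V) : \1_(Icyl 0 c) t = 1 :> R[i].
Proof. by rewrite indicE mem_set. Qed.

Lemma dirichlet_mulM b A t :
  D (b * M A) t = (\sum_(r < b) psi (r * M A) t) * D (M A) t.
Proof.
elim: b => [|b IH]; first by rewrite mul0n /D !big_ord0 mul0r.
by rewrite mulSn addnC dirichlet_shift// IH big_ord_recr/= mulrDl.
Qed.

(** Paley's lemma: D_{M_A} is the normalised indicator of the subgroup I_A. *)
Lemma dirichlet_M A t : D (M A) t = (M A)%:R * \1_(Icyl A 0) t.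
Proof.
elim: A => [|A IH].
  by rewrite Mprod0 /D big_ord1 psi0 indic_Icyl0 mul1r.
rewrite MprodS dirichlet_mulM IH indic_IcylS.
under eq_bigr => r _ do rewrite psi_mulM//.
by rewrite sum_rademacher// natrM; ring.
Qed.

Lemma indic_ge0 (S : set V) t : 0 <= \1_S t :> R[i].
Proof. by rewrite indicE ler0n. Qed.

Lemma norm_sum_psi_le b A (t : V) : `|\sum_(r < b) psi (r * M A) t| <= b%:R.
Proof.
rewrite (le_trans (ler_norm_sum _ _ _))//.
by under eq_bigr => r _ do rewrite norm_psi; rewrite sumr_const card_ord.
Qed.

Lemma norm_dirichlet_mulM b A t :
  `|D (b * M A) t| <= b%:R * ((M A)%:R * \1_(Icyl A 0) t).
Proof.
rewrite dirichlet_mulM normrM dirichlet_M [X in _ * X]ger0_norm.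
  by rewrite ler_wpM2r ?norm_sum_psi_le// mulr_ge0 ?indic_ge0.
by rewrite mulr_ge0 ?indic_ge0.
Qed.

(** For s < A this is the indicator of the points whose only nonzero coordinate
    of index below A is the one of index s.  For s = A all the cosets coincide
    with I_A, which is counted m_A - 1 times, as in the definition of W. *)
Definition spike s A (u : V) : R[i] :=
  \sum_(1 <= a < m s) \1_(Icyl A (mul_e m a s)) u.
Definition fejer_majorant A (u : V) : R[i] :=
  \sum_(s < A.+1) (M s)%:R * spike s A u.

Lemma spike_ge0 s A u : 0 <= spike s A u.
Proof. by apply: sumr_ge0 => a _; apply: indic_ge0. Qed.

Lemma fejer_majorant_ge0 A u : 0 <= fejer_majorant A u.
Proof. by apply: sumr_ge0 => a _; rewrite mulr_ge0 ?spike_ge0. Qed.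

Lemma indic_le_spike s A a u : (0 < a < m s)%N ->
  \1_(Icyl A (mul_e m a s)) u <= spike s A u.
Proof.
move=> a0; rewrite /spike (bigD1_seq a) ?mem_index_iota ?iota_uniq//=.
by rewrite lerDl; apply: sumr_ge0 => b _; apply: indic_ge0.
Qed.

Lemma indic_le_spike_diag A u : \1_(Icyl A (0 : V)) u <= spike A A u.
Proof.
apply: le_trans (@indic_le_spike A A 1 u _); last by rewrite m_ge2.
rewrite !indicE ler_nat.
case: (boolP (u \in Icyl A 0)) => // /set_mem u0; rewrite mem_set// => k kA.
by rewrite u0// /mul_e (ltn_eqF kA).
Qed.

Lemma indic_le_fejer_majorant A u :
  (M A)%:R * \1_(Icyl A (0 : V)) u <= fejer_majorant A u.
Proof.
rewrite /fejer_majorant big_ord_recr/= ler_wpDl ?ler_wpM2l ?indic_le_spike_diag//.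
by apply: sumr_ge0 => a _; rewrite mulr_ge0 ?spike_ge0.
Qed.

Definition zero_off s A : set V :=
  [set u | forall k, (k < A)%N -> k != s -> u k = 0].

Lemma indic_zero_offS s A u : (s < A)%N ->
  \1_(zero_off s A.+1) u = \1_(zero_off s A) u * (u A == 0)%:R :> R[i].
Proof.
move=> sA; rewrite !indicE -natrM mulnb; congr (_%:R); congr nat_of_bool.
apply/idP/andP => [/set_mem H|[/set_mem H /eqP uA]].
  split; first by apply/mem_set => k kA; apply: H; rewrite (ltn_trans kA).
  by rewrite H// gtn_eqF.
apply/mem_set => k; rewrite ltnS leq_eqVlt => /orP[/eqP ->//|]; exact: H.
Qed.

Lemma indic_zero_off_diag A u :
  \1_(zero_off A A.+1) u = \1_(Icyl A 0) u :> R[i].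
Proof.
rewrite !indicE; congr (_%:R); congr nat_of_bool.
apply/idP/idP => /set_mem H; apply/mem_set => k kA.
  by rewrite H// ?(ltn_trans kA)// ltn_eqF.
by move=> kA'; rewrite H// ltn_neqAle kA'.
Qed.

Lemma indic_zero_off_le s A u : (s < A)%N ->
  \1_(zero_off s A) u <= \1_(Icyl A 0) u + spike s A u.
Proof.
move=> sA; rewrite indicE; case: (boolP (u \in _)) => [/set_mem uJ|_]; last first.
  by rewrite addr_ge0 ?indic_ge0 ?spike_ge0.
have [us|us] := eqVneq (u s) 0.
  rewrite ler_wpDr ?spike_ge0// indicE mem_set// => k kA.
  by have [->|ks] := eqVneq k s; [|exact: uJ].
rewrite ler_wpDl ?indic_ge0//.
have us0 : (0 < u s < m s)%N.
  by rewrite ltn_Zm// andbT lt0n; apply: contra us => /eqP H; apply/eqP/val_inj.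
apply: le_trans (indic_le_spike A u us0); rewrite indicE mem_set// => k kA.
rewrite /mul_e; case: ifPn => [/eqP ->|ks]; last exact: uJ.
by rewrite natr_Zp.
Qed.

(** The recursion G_{M_{A+1}} = M_A sum_r D_{r M_A} + (sum_r r_A^r) G_{M_A}
    adds a term living on I_A, and multiplies the previous ones by m_A times the
    indicator of u_A = 0: a contribution born at level s survives on the points
    that vanish at every index below A other than s. *)
Lemma norm_fejer_sum_zero_off A u : `|G (M A) u| <=
  (M A)%:R * \sum_(s < A) (m s * M s)%:R * \1_(zero_off s A) u.
Proof.
elim: A => [|A IH].
  by rewrite Mprod0 /G big_ord1 /D !big_ord0 normr0 mulr0.
have GS b : G (b * M A) u = (M A)%:R * (\sum_(r < b) D (r * M A) u)
    + (\sum_(r < b) psi (r * M A) u) * G (M A) u.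
  elim: b => [|b IHb]; first by rewrite mul0n /G !big_ord0 mulr0 mul0r addr0.
  rewrite mulSn addnC fejer_sum_shift// IHb !big_ord_recr/= mulrDl !mulrDr.
  by ring.
rewrite MprodS GS big_ord_recr/= mulrDr addrC.
rewrite (le_trans (ler_normD _ _))// lerD//.
  under eq_bigr => r _ do rewrite psi_mulM//.
  rewrite sum_rademacher// !normrM !normr_nat.
  under [in leRHS]eq_bigr => s _ do rewrite indic_zero_offS// mulrA.
  rewrite -mulr_suml natrM mulrA -mulrA [_ * `|_|]mulrC -!mulrA ler_wpM2l//.
  by rewrite mulrA ler_wpM2r.
rewrite indic_zero_off_diag normrM normr_nat.
rewrite [X in _ <= X%:R * _]mulnC natrM -mulrA ler_wpM2l//.
rewrite (le_trans (ler_norm_sum _ _ _))//.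
have -> : (m A)%:R * ((m A * M A)%:R * \1_(Icyl A 0) u) =
    \sum_(r < m A) (m A)%:R * ((M A)%:R * \1_(Icyl A 0) u) :> R[i].
  by rewrite sumr_const card_ord -mulr_natl natrM; ring.
apply: ler_sum => r _; rewrite (le_trans (norm_dirichlet_mulM _ _ _))//.
by rewrite ler_wpM2r ?mulr_ge0 ?indic_ge0// ler_nat ltnW.
Qed.

Variable B : nat.
Hypothesis m_le : forall k, (m k <= B)%N.

Lemma B_ge2 : (2 <= B)%N. Proof. exact: leq_trans (m_le 0). Qed.

(** A point that vanishes off s either lies in I_A or carries a nonzero
    coordinate s, which is counted by spike s A; the masses put on I_A add up to
    at most 2 M_A because M grows geometrically. *)
Lemma norm_fejer_sum_M A u :
  `|G (M A) u| <= B%:R * ((M A)%:R * fejer_majorant A u).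
Proof.
rewrite (le_trans (norm_fejer_sum_zero_off A u))// mulrCA ler_wpM2l//.
apply: (@le_trans _ _ (\sum_(s < A) (B%:R * ((M s)%:R * spike s A u) +
   (M s.+1)%:R * \1_(Icyl A 0) u))).
  apply: ler_sum => s _.
  apply: (le_trans (ler_wpM2l _ (indic_zero_off_le u (ltn_ord s)))) => //.
  rewrite mulrDr addrC MprodS lerD// natrM mulrA ler_wpM2r ?spike_ge0//.
  by rewrite ler_wpM2r// ler_nat.
rewrite big_split/= -mulr_sumr /fejer_majorant big_ord_recr/= mulrDr lerD//.
rewrite -mulr_suml mulrA -natr_sum ler_pM ?indic_ge0 ?indic_le_spike_diag//.
rewrite -natrM ler_nat (@leq_trans (2 * M A))%N ?leq_mul2r ?B_ge2 ?orbT//.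
apply: leq_trans (sum_Mprod_le m_ge2 A).
by rewrite big_ord_recl/= leq_addl.
Qed.

Lemma norm_fejer_sum_mulM b A u : (b <= m A)%N ->
  `|G (b * M A) u| <= (2 * B ^ 2)%:R * ((M A)%:R * fejer_majorant A u).
Proof.
move=> bA; have bB : (b <= B)%N := leq_trans bA (m_le A).
apply: (@le_trans _ _ (b%:R * ((2 * B)%:R * ((M A)%:R * fejer_majorant A u))));
  last first.
  rewrite mulrA ler_wpM2r ?mulr_ge0 ?fejer_majorant_ge0// -natrM ler_nat.
  by rewrite mulnCA leq_mul2l/= -mulnn leq_mul2r bB orbT.
elim: b bA bB => [|b IHb] bA bB.
  by rewrite mul0n /G big_ord0 normr0 mul0r.
rewrite mulSn addnC fejer_sum_shift// -natr1 mulrDl mul1r.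
rewrite -addrA (le_trans (ler_normD _ _))// lerD ?IHb 1?ltnW//.
rewrite (le_trans (ler_normD _ _))// mul2n -addnn natrD mulrDl lerD//.
  rewrite normrM normr_nat mulrCA ler_wpM2l//.
  rewrite (le_trans (norm_dirichlet_mulM _ _ _))//.
  by rewrite ler_pM ?mulr_ge0 ?indic_ge0 ?indic_le_fejer_majorant// ler_nat ltnW.
by rewrite normrM norm_psi// mul1r norm_fejer_sum_M.
Qed.

(** The blocks cut by the successive digits of n each obey the bound for G at
    a multiple of M_A, so a peeled leading digit costs one more term. *)
Lemma norm_fejer_sum_le n N u : (n < M N)%N ->
  `|G n u| <= (3 * B ^ 2)%:R * \sum_(A < N) (M A)%:R * fejer_majorant A u.
Proof.
elim: N n => [|N IH] n.
  by rewrite Mprod0 ltnS leqn0 => /eqP ->; rewrite /G !big_ord0 normr0 mulr0.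
move=> /(leading_digit m_ge2)[b [l [bN lN ->]]].
rewrite fejer_sum_shift 1?ltnW// big_ord_recr/= mulrDr addrC.
rewrite (le_trans (ler_normD _ _))// lerD//.
  by rewrite normrM norm_psi// mul1r IH.
rewrite (le_trans (ler_normD _ _))// mulSn natrD mulrDl [leRHS]addrC lerD//.
  by rewrite norm_fejer_sum_mulM// ltnW.
rewrite normrM normr_nat.
apply: (@le_trans _ _ ((M N)%:R * (B%:R * fejer_majorant N u))).
  rewrite ler_pM ?ler_nat 1?ltnW// (le_trans (norm_dirichlet_mulM _ _ _))//.
  rewrite ler_pM ?mulr_ge0 ?indic_ge0 ?indic_le_fejer_majorant// ler_nat.
  by rewrite (leq_trans (ltnW bN)).
rewrite mulrCA ler_wpM2r ?mulr_ge0 ?fejer_majorant_ge0// ler_nat -mulnn.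
by rewrite leq_pmull// (leq_trans _ B_ge2).
Qed.

(** The basic kernels of which all the terms of W are made. *)
Definition cross_majorant j i (t u : V) : R[i] :=
  \1_(Icyl j 0) t * fejer_majorant i u + fejer_majorant i t * \1_(Icyl j 0) u.

Lemma cross_majorant_ge0 j i t u : 0 <= cross_majorant j i t u.
Proof. by rewrite addr_ge0 ?mulr_ge0 ?indic_ge0 ?fejer_majorant_ge0. Qed.

(** What the r-th block of M_A consecutive indices contributes to the
    Marcinkiewicz kernel besides a unimodular multiple of K_{M_A}. *)
Definition cross_terms r A (t u : V) : R[i] :=
  (M A)%:R * (D (r * M A) t * D (r * M A) u)
  + (D (r * M A) t * (psi (r * M A) u * G (M A) u)
     + psi (r * M A) t * G (M A) t * D (r * M A) u).

Lemma norm_dirichlet_mul_le b A (u t : V) (z g : R[i]) :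
  (b <= B)%N -> `|g| <= z ->
  `|D (b * M A) t * (psi (b * M A) u * g)|
    <= B%:R * ((M A)%:R * \1_(Icyl A 0) t) * z.
Proof.
move=> bB gz; rewrite !normrM norm_psi// mul1r ler_pM//.
rewrite (le_trans (norm_dirichlet_mulM _ _ _))//.
rewrite ler_wpM2r ?mulr_ge0 ?indic_ge0//.
by rewrite ler_nat.
Qed.

Lemma norm_dirichlet_mulM2 b A (t u : V) : (b <= B)%N ->
  `|D (b * M A) t * D (b * M A) u|
    <= (B ^ 2)%:R * ((M A)%:R * cross_majorant A A t u).
Proof.
move=> bB; rewrite normrM.
apply: (@le_trans _ _ ((B%:R * ((M A)%:R * \1_(Icyl A 0) t)) *
                      (B%:R * fejer_majorant A u))).
  rewrite ler_pM//.
    rewrite (le_trans (norm_dirichlet_mulM _ _ _))//.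
    rewrite ler_wpM2r ?mulr_ge0 ?indic_ge0//.
    by rewrite ler_nat.
  rewrite (le_trans (norm_dirichlet_mulM _ _ _))//.
  by rewrite ler_pM ?mulr_ge0 ?indic_ge0 ?indic_le_fejer_majorant// ler_nat.
rewrite mulrACA -natrM mulnn ler_wpM2l// -mulrA ler_wpM2l// /cross_majorant.
by rewrite lerDl mulr_ge0 ?indic_ge0 ?fejer_majorant_ge0.
Qed.

Lemma norm_cross_terms r A t u : (r <= B)%N ->
  `|cross_terms r A t u| <=
  (2 * B ^ 2)%:R * ((M A)%:R ^+ 2 * cross_majorant A A t u).
Proof.
move=> rB; rewrite /cross_terms mul2n -addnn natrD mulrDl.
rewrite (le_trans (ler_normD _ _))// lerD//.
  rewrite normrM normr_nat expr2 -mulrA mulrCA ler_wpM2l//.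
  exact: norm_dirichlet_mulM2.
rewrite (le_trans (ler_normD _ _))//.
rewrite [X in `|_| + `|X|]mulrC.
apply: (le_trans (lerD (norm_dirichlet_mul_le A u t rB (norm_fejer_sum_M A u))
                       (norm_dirichlet_mul_le A t u rB (norm_fejer_sum_M A t)))).
rewrite /cross_majorant -mulnn natrM le_eqVlt; apply/orP; left; apply/eqP.
by ring.
Qed.

(** The copies of K_{M_A} are not estimated one by one: their unimodular factors
    are kept together, and for b = m_A they add up to the Rademacher sum at
    t + u. *)
Lemma marcinkiewicz_sum_mulM b A t u :
  K (b * M A) t u = \sum_(r < b) cross_terms r A t u
    + (\sum_(r < b) psi (r * M A) (t + u)) * K (M A) t u.
Proof.
elim: b => [|b IH]; first by rewrite mul0n /K !big_ord0 mul0r addr0.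
rewrite mulSn addnC marcinkiewicz_sum_shift// IH !big_ord_recr/= /cross_terms.
move: (\sum_(_ < b) _) (\sum_(_ < b) _) (K _ _ _) (psi _ (t + u)) => S P Q p.
by rewrite mulrDl !addrA; congr (_ + _); rewrite -!addrA; congr (_ + _); ring.
Qed.

(** The kernel of the first two parts of M_A W_A.  The cut at A.-1 makes rprod
    the product of the Rademacher sums of index k+1, ..., A-1. *)
Definition block_majorant A (t u : V) : R[i] :=
  \sum_(k < A) (M k)%:R ^+ 2 * cross_majorant k k t u * rprod R k.+1 A.-1 t u.

Lemma rprod_ge0 i n (t u : V) : 0 <= rprod R i n t u.
Proof. by rewrite rprodE//; apply: prodr_ge0 => l _; rewrite mulr_ge0. Qed.

Lemma rprod_nil A (t u : V) : rprod R A.+1 A t u = 1.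
Proof. by rewrite rprodE// big_geq. Qed.

Lemma rprod_recr k A (t u : V) : (k < A)%N ->
  rprod R k.+1 A t u = (m A)%:R * (t A + u A == 0)%:R * rprod R k.+1 A.-1 t u.
Proof.
by case: A => // A kA; rewrite !rprodE// big_nat_recr//= mulrC.
Qed.

Lemma block_majorant_ge0 A t u : 0 <= block_majorant A t u.
Proof.
apply: sumr_ge0 => k _.
by rewrite !mulr_ge0 ?cross_majorant_ge0 ?rprod_ge0 ?exprn_ge0.
Qed.

Lemma block_majorantS A t u : block_majorant A.+1 t u =
  (M A)%:R ^+ 2 * cross_majorant A A t u
  + (m A)%:R * (t A + u A == 0)%:R * block_majorant A t u.
Proof.
rewrite /block_majorant big_ord_recr/= rprod_nil mulr1 addrC mulr_sumr.
congr (_ + _).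
by apply: eq_bigr => k _; rewrite rprod_recr// mulrCA.
Qed.

Lemma norm_sum_cross_terms b A t u : (b <= B)%N ->
  `|\sum_(r < b) cross_terms r A t u| <=
  (2 * B ^ 3)%:R * ((M A)%:R ^+ 2 * cross_majorant A A t u).
Proof.
move=> bB; rewrite (le_trans (ler_norm_sum _ _ _))//.
apply: (@le_trans _ _ (\sum_(r < b)
    (2 * B ^ 2)%:R * ((M A)%:R ^+ 2 * cross_majorant A A t u))).
  apply: ler_sum => r _.
  by rewrite norm_cross_terms// (leq_trans (ltnW (ltn_ord r))).
rewrite sumr_const card_ord -[leLHS]mulr_natl [leLHS]mulrA -natrM.
rewrite ler_wpM2r ?mulr_ge0 ?cross_majorant_ge0 ?exprn_ge0// ler_nat.
by rewrite expnS mulnCA leq_mul2l/= leq_mul2r bB orbT.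
Qed.

(** block_majorant satisfies the recursion of K_{M_A} with equality: one new
    cross term, and the factor m_A [t_A + u_A = 0] on the old ones.  Taking
    absolute values before summing over r would lose that indicator. *)
Lemma norm_marcinkiewicz_sum_M A t u :
  `|K (M A) t u| <= (2 * B ^ 3)%:R * block_majorant A t u.
Proof.
elim: A => [|A IH].
  rewrite Mprod0 /K big_ord1 /D !big_ord0 mul0r normr0.
  by rewrite /block_majorant big_ord0 mulr0.
rewrite block_majorantS MprodS marcinkiewicz_sum_mulM mulrDr.
rewrite (le_trans (ler_normD _ _))// lerD ?norm_sum_cross_terms ?m_le//.
under eq_bigr => r _ do rewrite psi_mulM//.
rewrite sum_rademacher// !normrM !normr_nat mulrCA ler_wpM2l ?mulr_ge0//.
Qed.

(** The kernel against which Delta has the integral M_A W_A. *)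
Definition W_kernel A (t u : V) : R[i] := block_majorant A t u + (M A)%:R *
  \sum_(i < A.+1) (M i)%:R * cross_majorant A i t u.

(** The pointwise heart of the proof.  Write n = b M_N + l with leading digit b.
    The b full blocks are bounded by block_majorant and a cross term, the mixed
    terms D_{b M_N} (t) G_l (u) by the edge part of the kernel of M_N W_N since
    D_{b M_N} lives on I_N, and K_l by induction on N. *)
Lemma norm_marcinkiewicz_sum_le n N t u : (n < M N)%N ->
  `|K n t u| <= (3 * B ^ 4)%:R * \sum_(A < N) W_kernel A t u.
Proof.
elim: N n => [|N IH] n.
  by rewrite Mprod0 ltnS leqn0 => /eqP ->; rewrite /K !big_ord0 normr0 mulr0.
move=> /(leading_digit m_ge2)[b [l [bN lN ->]]].
have bB : (b <= B)%N := leq_trans (ltnW bN) (m_le N).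
have B1 : (0 < B)%N := ltn_trans (isT : 0 < 1)%N B_ge2.
rewrite marcinkiewicz_sum_shift 1?ltnW// big_ord_recr/= mulrDr addrC.
rewrite (le_trans (ler_normD _ _))// lerD//.
  by rewrite normrM norm_psi// mul1r IH.
rewrite marcinkiewicz_sum_mulM /W_kernel big_ord_recr/=.
set S := \sum_(i < N) _.
have SE : S = \1_(Icyl N 0) t * (\sum_(i < N) (M i)%:R * fejer_majorant i u) +
              (\sum_(i < N) (M i)%:R * fejer_majorant i t) * \1_(Icyl N 0) u.
  rewrite mulr_sumr mulr_suml -big_split/=; apply: eq_bigr => i _.
  by rewrite /cross_majorant; ring.
have S0 : 0 <= S.
  by apply: sumr_ge0 => i _; rewrite mulr_ge0 ?cross_majorant_ge0.
have DG : `|D (b * M N) t * (psi (b * M N) u * G l u)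
     + psi (b * M N) t * G l t * D (b * M N) u| <=
  (3 * B ^ 3)%:R * ((M N)%:R * S).
  rewrite (le_trans (ler_normD _ _))//.
  rewrite [X in `|_| + `|X|]mulrC.
  apply: (le_trans (lerD (norm_dirichlet_mul_le N u t bB (norm_fejer_sum_le u lN))
                       (norm_dirichlet_mul_le N t u bB (norm_fejer_sum_le t lN)))).
  rewrite SE expnS mulnCA natrM le_eqVlt; apply/orP; left; apply/eqP; ring.
have DD : `|l%:R * (D (b * M N) t * D (b * M N) u)| <=
   (B ^ 2)%:R * ((M N)%:R * ((M N)%:R * cross_majorant N N t u)).
  rewrite normrM normr_nat [leRHS]mulrCA ler_pM ?ler_nat 1?ltnW//.
  exact: norm_dirichlet_mulM2.
have KR := norm_sum_cross_terms N t u bB.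
have KM : `|(\sum_(r < b) psi (r * M N) (t + u)) * K (M N) t u| <=
    (2 * B ^ 4)%:R * block_majorant N t u.
  rewrite normrM expnS mulnCA natrM -mulrA ler_pM ?norm_marcinkiewicz_sum_M//.
  by rewrite (le_trans (norm_sum_psi_le _ _ _))// ler_nat.
set X := cross_majorant N N t u in DD KR *; set Q := block_majorant N t u in KM *.
apply: (@le_trans _ _ ((2 * B ^ 3)%:R * ((M N)%:R ^+ 2 * X) +
   (2 * B ^ 4)%:R * Q + (B ^ 2)%:R * ((M N)%:R * ((M N)%:R * X))
   + (3 * B ^ 3)%:R * ((M N)%:R * S))).
  apply: (le_trans (ler_normD _ _)); rewrite lerD//.
  apply: (le_trans (ler_normD _ _)); rewrite lerD//.
  by apply: (le_trans (ler_normD _ _)); rewrite lerD.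
have -> : (2 * B ^ 3)%:R * ((M N)%:R ^+ 2 * X) +
   (2 * B ^ 4)%:R * Q + (B ^ 2)%:R * ((M N)%:R * ((M N)%:R * X))
   + (3 * B ^ 3)%:R * ((M N)%:R * S) =
   (2 * B ^ 4)%:R * Q + ((2 * B ^ 3 + B ^ 2)%:R * ((M N)%:R ^+ 2 * X)
     + (3 * B ^ 3)%:R * ((M N)%:R * S)) by rewrite natrD; ring.
have -> : (3 * B ^ 4)%:R * (Q + (M N)%:R * (S + (M N)%:R * X)) =
   (3 * B ^ 4)%:R * Q + ((3 * B ^ 4)%:R * ((M N)%:R ^+ 2 * X)
     + (3 * B ^ 4)%:R * ((M N)%:R * S)) by ring.
have B34 : (B ^ 3 <= B ^ 4)%N by rewrite leq_pexp2l.
have B24 : (B ^ 2 <= B ^ 4)%N by rewrite leq_pexp2l.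
have X0 : 0 <= X := cross_majorant_ge0 N N t u.
have Q0 : 0 <= Q := block_majorant_ge0 N t u.
by rewrite !lerD// ler_wpM2r ?mulr_ge0 ?exprn_ge0// ler_nat; lia.
Qed.

End Kernels.

(** * Integration of complex-valued functions *)

Section ComplexMeasurable.
Context d (T : measurableType d) (R : realType).
Implicit Types (f g : T -> R[i]).

(** Measurability is taken componentwise, to match the componentwise
    definition of integrability and of the integral. *)
Definition Cmeasurable f :=
  measurable_fun setT (fun z => complex.Re (f z)) /\
  measurable_fun setT (fun z => complex.Im (f z)).

Lemma Cmeasurable_cst c : Cmeasurable (fun=> c).
Proof. by split; apply: measurable_cst. Qed.

Lemma CmeasurableD f g : Cmeasurable f -> Cmeasurable g ->
  Cmeasurable (fun z => f z + g z).
Proof.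
move=> [rf jf] [rg jg]; split.
  under eq_fun do rewrite raddfD/=; exact: measurable_funD.
under eq_fun do rewrite raddfD/=; exact: measurable_funD.
Qed.

Lemma ReM (x y : R[i]) : complex.Re (x * y) =
  complex.Re x * complex.Re y - complex.Im x * complex.Im y.
Proof. by case: x; case: y. Qed.

Lemma ImM (x y : R[i]) : complex.Im (x * y) =
  complex.Re x * complex.Im y + complex.Im x * complex.Re y.
Proof. by case: x => a b; case: y. Qed.

Lemma CmeasurableM f g : Cmeasurable f -> Cmeasurable g ->
  Cmeasurable (fun z => f z * g z).
Proof.
move=> [rf jf] [rg jg]; split.
  under eq_fun do rewrite ReM.
  by apply: measurable_funB; apply: measurable_funM.
under eq_fun do rewrite ImM.
by apply: measurable_funD; apply: measurable_funM.
Qed.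

Lemma Cmeasurable_norm f : Cmeasurable f -> Cmeasurable (fun z => `|f z|).
Proof.
move=> [rf jf]; split; under eq_fun do rewrite normc_def/=;
  last exact: measurable_cst.
apply: (@measurableT_comp _ _ _ _ _ _ (@Num.sqrt R)) => //.
  exact: continuous_measurable_fun (@sqrt_continuous R).
by apply: measurable_funD; apply: measurable_funX.
Qed.

Lemma Cmeasurable_prod (I : Type) (s : seq I) (F : I -> T -> R[i]) :
  (forall i, Cmeasurable (F i)) -> Cmeasurable (fun z => \prod_(i <- s) F i z).
Proof.
move=> mF; elim: s => [|i s IH].
  by under eq_fun do rewrite big_nil; apply: Cmeasurable_cst.
by under eq_fun do rewrite big_cons; apply: CmeasurableM.
Qed.

Lemma CmeasurableX f n : Cmeasurable f -> Cmeasurable (fun z => f z ^+ n).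
Proof.
move=> mf; elim: n => [|n IH].
  by under eq_fun do rewrite expr0; apply: Cmeasurable_cst.
by under eq_fun do rewrite exprS; apply: CmeasurableM.
Qed.

Lemma Cmeasurable_indic (A : set T) : measurable A ->
  Cmeasurable (fun z => \1_A z).
Proof.
move=> mA; split.
  have -> : (fun z => complex.Re (\1_A z : R[i])) = (\1_A : T -> R).
    by apply/funext => z; rewrite !indicE; case: (z \in A).
  exact: measurable_indic.
have -> : (fun z => complex.Im (\1_A z : R[i])) = cst 0.
  by apply/funext => z; rewrite !indicE; case: (z \in A).
exact: measurable_cst.
Qed.

End ComplexMeasurable.

Lemma Cmeasurable_comp d1 d2 (T1 : measurableType d1) (T2 : measurableType d2)
  (R : realType) (f : T2 -> R[i]) (phi : T1 -> T2) :
  measurable_fun setT phi -> Cmeasurable f -> Cmeasurable (fun z => f (phi z)).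
Proof.
move=> mp [rf jf].
by split; [apply: (measurableT_comp rf)|apply: (measurableT_comp jf)].
Qed.

Section ComplexIntegralTheory.
Context d (T : measurableType d) (R : realType).
Variable nu : {measure set T -> \bar R}.
Implicit Types (f g : T -> R[i]).
Local Notation CI := (Cintegral nu setT).
Local Notation Cint := (Cintegrable nu).

Lemma Cintegrable_measurable f : Cint f -> Cmeasurable f.
Proof.
by move=> [/measurable_int/measurable_EFinP mr /measurable_int/measurable_EFinP mi].
Qed.

Lemma norm_Im_le (x : R[i]) : (`|complex.Im x|)%:C <= `|x|.
Proof.
by rewrite normc_def lecR -sqrtr_sqr ler_wsqrtr// lerDr sqr_ge0.
Qed.

Lemma norm_le_ReIm (x : R[i]) : `|x| <= (`|complex.Re x| + `|complex.Im x|)%:C.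
Proof.
rewrite normc_def lecR -[leRHS]ger0_norm ?addr_ge0// -sqrtr_sqr ler_wsqrtr//.
rewrite sqrrD !real_normK ?num_real// addrAC lerDl.
by rewrite mulrn_wge0// mulr_ge0.
Qed.

(** Real and imaginary parts of f are dominated by |Re g| + |Im g|. *)
Lemma Cintegrable_le f g : Cmeasurable f -> (forall z, `|f z| <= `|g z|) ->
  Cint g -> Cint f.
Proof.
move=> [rf jf] fg [gr gi].
have H : nu.-integrable setT
    (fun z => (`|complex.Re (g z)| + `|complex.Im (g z)|)%:E).
  exact: (integrableD measurableT (integrable_norm gr) (integrable_norm gi)).
split; apply: le_integrable H => //; try exact/measurable_EFinP.
  move=> z _; rewrite /= lee_fin -lecR.
  rewrite (le_trans (normc_ge_Re _))// (le_trans (fg z))//.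
  by rewrite [X in X%:C]ger0_norm ?addr_ge0// norm_le_ReIm.
move=> z _; rewrite /= lee_fin -lecR.
rewrite (le_trans (norm_Im_le _))// (le_trans (fg z))//.
by rewrite [X in X%:C]ger0_norm ?addr_ge0// norm_le_ReIm.
Qed.

Lemma CintegrableD f g : Cint f -> Cint g -> Cint (fun z => f z + g z).
Proof.
move=> [fr fi] [gr gi]; split.
  under eq_fun do rewrite raddfD/=; exact: (integrableD measurableT fr gr).
under eq_fun do rewrite raddfD/=; exact: (integrableD measurableT fi gi).
Qed.

Lemma CintegrableZ c f : Cint f -> Cint (fun z => c * f z).
Proof.
move=> [fr fi]; split.
  under eq_fun do rewrite ReM EFinB !EFinM.
  exact: (integrableB measurableT (integrableZl measurableT _ fr)
                                  (integrableZl measurableT _ fi)).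
under eq_fun do rewrite ImM EFinD !EFinM.
exact: (integrableD measurableT (integrableZl measurableT _ fi)
                                (integrableZl measurableT _ fr)).
Qed.

Lemma Cintegrable_norm f : Cint f -> Cint (fun z => `|f z|).
Proof.
move=> fi; apply: (Cintegrable_le _ _ fi) => [|z]; last by rewrite normr_id.
exact: Cmeasurable_norm (Cintegrable_measurable fi).
Qed.

Lemma CintegrableMr f g c : Cint f -> Cmeasurable g ->
  (forall z, `|g z| <= c) -> Cint (fun z => f z * g z).
Proof.
move=> fi mg gc; apply: (@Cintegrable_le _ (fun z => c * f z)).
- exact: CmeasurableM (Cintegrable_measurable fi) mg.
- move=> z; rewrite !normrM mulrC ler_wpM2r//.
  by rewrite (le_trans (gc z))// real_ler_norm// ger0_real// (le_trans _ (gc z)).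
- exact: CintegrableZ.
Qed.

Lemma Cintegrable_sum (I : Type) (s : seq I) (F : I -> T -> R[i]) :
  (forall i, Cint (F i)) -> Cint (fun z => \sum_(i <- s) F i z).
Proof.
move=> iF; elim: s => [|i s IH].
  under eq_fun do rewrite big_nil.
  by split; apply: integrable0.
by under eq_fun do rewrite big_cons; apply: CintegrableD.
Qed.

Lemma eq_Cintegral D f g : f =1 g -> Cintegral nu D f = Cintegral nu D g.
Proof. by move=> /funext ->. Qed.

Lemma CintegralD f g : Cint f -> Cint g ->
  CI (fun z => f z + g z) = CI f + CI g.
Proof.
move=> [fr fi] [gr gi]; apply/eqP; rewrite eq_complex/=.
rewrite -!RintegralD//; apply/andP; split; apply/eqP.
  by apply: eq_Rintegral => z _; rewrite raddfD.
by apply: eq_Rintegral => z _; rewrite raddfD.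
Qed.

Lemma CintegralZ c f : Cint f -> CI (fun z => c * f z) = c * CI f.
Proof.
move=> [fr fi]; apply/eqP; rewrite eq_complex ReM ImM/=.
have mT := @measurableT _ T.
have iZ (r : R) (h : T -> R) : nu.-integrable setT (EFin \o h) ->
    nu.-integrable setT (EFin \o (fun z => r * h z)).
  by move=> hi; exact: (integrableZl mT r hi).
rewrite -!(RintegralZl _ mT)// -RintegralB ?iZ//.
rewrite -RintegralD ?iZ//; apply/andP; split; apply/eqP.
  by apply: eq_Rintegral => z _; rewrite ReM.
by apply: eq_Rintegral => z _; rewrite ImM.
Qed.

Lemma Cintegral_sum (I : Type) (s : seq I) (F : I -> T -> R[i]) :
  (forall i, Cint (F i)) ->
  CI (fun z => \sum_(i <- s) F i z) = \sum_(i <- s) CI (F i).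
Proof.
move=> iF; elim: s => [|i s IH].
  rewrite big_nil -[RHS](mul0r (CI (fun=> 0))) -CintegralZ; last first.
    by split; apply: integrable0.
  by apply: eq_Cintegral => z; rewrite big_nil mul0r.
rewrite big_cons -IH -CintegralD//; last exact: Cintegrable_sum.
by apply: eq_Cintegral => z; rewrite big_cons.
Qed.

Lemma le_Cintegral f g : Cint f -> Cint g -> (forall z, f z <= g z) ->
  CI f <= CI g.
Proof.
move=> [fr fi] [gr gi] fg; rewrite lecE/=; apply/andP; split.
  apply/eqP; apply: eq_Rintegral => z _.
  by have := fg z; rewrite lecE => /andP[/eqP].
apply: le_Rintegral => // z _.
by have := fg z; rewrite lecE => /andP[].
Qed.

Lemma Cintegral_ge0 f : (forall z, 0 <= f z) -> 0 <= CI f.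
Proof.
move=> f0; rewrite lecE/=; apply/andP; split; last first.
  by apply: Rintegral_ge0 => z _; have := f0 z; rewrite lecE => /andP[].
rewrite (_ : Rintegral _ _ _ = Rintegral nu setT (cst 0)).
  by rewrite Rintegral_cst// mul0r.
by apply: eq_Rintegral => z _; have := f0 z; rewrite lecE => /andP[/eqP].
Qed.

(** The sharp constant is 1, but bounding real and imaginary parts separately is
    enough here, since constants do not matter. *)
Lemma norm_Cintegral_le f : Cint f -> `|CI f| <= 2 * CI (fun z => `|f z|).
Proof.
move=> fi; have := fi => -[fr fj].
rewrite (le_trans (norm_le_ReIm _))//= rmorphD/=.
have [nr nj] := Cintegrable_norm fi.
have nE : CI (fun z => `|f z|) =
    (Rintegral nu setT (fun z => complex.Re `|f z|))%:C.
  apply/eqP; rewrite eq_complex/= eqxx/=.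
  rewrite (_ : Rintegral _ _ _ = Rintegral nu setT (cst 0)).
    by rewrite Rintegral_cst// mul0r.
  exact: eq_Rintegral.
rewrite nE mulr_natl mulr2n lerD// lecR (le_trans (le_normr_Rintegral _ _))//.
  apply: le_Rintegral => //; first exact: integrable_norm.
  by move=> z _; rewrite -lecR (le_trans (normc_ge_Re _))// normc_def lexx.
apply: le_Rintegral => //; first exact: integrable_norm.
by move=> z _; rewrite -lecR (le_trans (norm_Im_le _))// normc_def lexx.
Qed.

Lemma Cintegral_mkcond (D : set T) f :
  Cintegral nu D f = CI (fun z => \1_D z * f z).
Proof.
apply/eqP; rewrite eq_complex/=; rewrite 2!(Rintegral_mkcond _ D).
apply/andP; split; apply/eqP; apply: eq_Rintegral => z _;
  by rewrite patchE indicE; case: ifPn => _; rewrite ?mul1r ?mul0r.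
Qed.

Lemma Cintegral_cst (c : R[i]) : nu setT = 1%E -> CI (fun=> c) = c.
Proof.
move=> n1; rewrite /Cintegral !Rintegral_cst// n1/= !mulr1.
by case: c.
Qed.

Lemma Cintegrable_cst (c : R[i]) : (nu setT < +oo)%E -> Cint (fun=> c).
Proof.
move=> noo; split; (apply/integrableP; split; first exact: measurable_cst);
  rewrite /= integral_cst// lte_mul_pinfty//.
Qed.

Lemma Cintegral_comp (phi : T -> T) f : measurable_fun setT phi ->
  (forall A, measurable A -> nu (phi @^-1` A) = nu A) ->
  Cmeasurable f -> Cint (fun z => f (phi z)) ->
  CI (fun z => f (phi z)) = CI f.
Proof.
move=> mphi inv [mr mj] [fr fj].
have E (h : T -> R) : measurable_fun setT h ->
    nu.-integrable setT (fun z => (h (phi z))%:E) ->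
    Rintegral nu setT (fun z => h (phi z)) = Rintegral nu setT h.
  move=> mh hi; rewrite /Rintegral; congr fine.
  transitivity (\int[pushforward nu phi]_z (h z)%:E)%E.
    rewrite integral_pushforward//; exact/measurable_EFinP.
  by apply: eq_measure_integral => A mA _; exact: inv.
rewrite /Cintegral (E (fun z => complex.Re (f z)))//.
by rewrite (E (fun z => complex.Im (f z))).
Qed.

Lemma Cintegrable_comp (phi : T -> T) f : measurable_fun setT phi ->
  (forall A, measurable A -> nu (phi @^-1` A) = nu A) ->
  Cint f -> Cint (fun z => f (phi z)).
Proof.
move=> mphi inv fi; have [mr mj] := Cintegrable_measurable fi.
have E (h : T -> R) : measurable_fun setT h ->
    nu.-integrable setT (fun z => (h z)%:E) ->
    nu.-integrable setT (fun z => (h (phi z))%:E).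
  move=> mh /integrableP[_ hi]; apply/integrableP; split.
    exact/measurable_EFinP/measurableT_comp.
  apply: le_lt_trans hi; rewrite le_eqVlt; apply/orP; left; apply/eqP.
  transitivity (\int[pushforward nu phi]_z `|(h z)%:E|)%E.
    rewrite ge0_integral_pushforward//.
    by apply: measurableT_comp => //; exact/measurable_EFinP.
  by apply: eq_measure_integral => A mA _; exact: inv.
by case: fi => fr fj; split; [exact: (E (fun z => complex.Re (f z)))
                             |exact: (E (fun z => complex.Im (f z)))].
Qed.

End ComplexIntegralTheory.

(** * Invariance of Haar measure under reflections *)

Section HaarInvariance.
Variables (R : realType) (m : nat -> nat).
Local Notation V := (vilenkin m).

Lemma vaddE (x y : V) k : (x + y)%R k = x k + y k. Proof. by []. Qed.
Lemma voppE (x : V) k : (- x)%R k = - x k. Proof. by []. Qed.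

Lemma measurable_coord k (a : 'Z_(m k)) : measurable ([set x | x k = a] : set V).
Proof. by apply: sub_sigma_algebra; exists k, a. Qed.

Lemma measurable_coord_set k (P : set 'Z_(m k)) :
  measurable ([set x | P (x k)] : set V).
Proof.
have -> : ([set x | P (x k)] : set V) = \bigcup_(a in P) [set x | x k = a].
  by apply/seteqP; split => [x Px|x [a Pa /= ->]//]; exists (x k).
apply: fin_bigcup_measurable; first exact: finite_finset.
by move=> a _; apply: measurable_coord.
Qed.

Lemma Cmeasurable_coord k (g : 'Z_(m k) -> R[i]) :
  Cmeasurable (fun x : V => g (x k)).
Proof.
split=> _ Y mY; rewrite setTI.
  exact: (@measurable_coord_set k (fun a => Y (complex.Re (g a)))).
exact: (@measurable_coord_set k (fun a => Y (complex.Im (g a)))).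
Qed.

Lemma Cmeasurable_psi n : Cmeasurable (fun x : V => psi R n x).
Proof.
apply: Cmeasurable_prod => k; apply: CmeasurableX.
exact: (@Cmeasurable_coord k (fun a => cexpi (2 * pi * (a : nat)%:R / (m k)%:R))).
Qed.

Lemma measurable_Icyl n (c : V) : measurable (Icyl n c).
Proof.
have -> : Icyl n c = \bigcap_(k in `I_n) [set x | x k = c k].
  by apply/seteqP; split => x H k; apply: H.
apply: fin_bigcap_measurable => [|k _]; first exact: finite_II.
exact: measurable_coord.
Qed.

(** The sets on which Haar measure is prescribed.  They form a pi-system which
    generates the sigma-algebra and is mapped to itself by reflections. *)
Definition box n (A : forall k : nat, {set 'Z_(m k)}) : set V :=
  [set x | forall k, (k < n)%N -> x k \in A k].

Definition boxes : set (set V) := [set S | exists n A, S = box n A].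

Lemma measurable_box n A : measurable (box n A).
Proof.
have -> : box n A = \bigcap_(k in `I_n) [set x | x k \in A k].
  by apply/seteqP; split => x H k; apply: H.
apply: fin_bigcap_measurable => [|k _]; first exact: finite_II.
exact: (@measurable_coord_set k (fun a => a \in A k)).
Qed.

Lemma boxesI : setI_closed boxes.
Proof.
move=> _ _ [n [A ->]] [p [A' ->]].
exists (maxn n p), (fun k =>
  [set z | ((k < n)%N ==> (z \in A k)) && ((k < p)%N ==> (z \in A' k))]%SET).
apply/seteqP; split => x /=.
  move=> [H H'] k _; rewrite !inE.
  by apply/andP; split; apply/implyP; [exact: H|exact: H'].
move=> H; split=> k kn.
  by have := H k; rewrite leq_max kn !inE/= => /(_ isT)/andP[].
by have := H k; rewrite leq_max kn orbT !inE/= => /(_ isT)/andP[].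
Qed.

Lemma measurable_boxes : measurable = <<s boxes >> :> set (set V).
Proof.
apply/seteqP; split; last first.
  apply: smallest_sub; first exact: sigma_algebra_measurable.
  by move=> _ [n [A ->]]; apply: measurable_box.
apply: smallest_sub; first exact: smallest_sigma_algebra.
move=> _ [k [a ->]]; apply: sub_sigma_algebra.
exists k.+1, (fun j => [set z : 'Z_(m j) | (j == k) ==> (z == a :> nat)]%SET).
apply/seteqP; split => x /= H.
  by move=> j _; rewrite inE; apply/implyP => /eqP jk; subst j; rewrite H.
have := H k (ltnSn k); rewrite inE eqxx/= => /eqP xa; exact: val_inj.
Qed.

Lemma measurable_reflect (x : V) : measurable_fun setT (fun t : V => x - t).
Proof.
apply: (measurability (coordinate_sets (m := m))) => //.
move=> _ [_ [k [a ->]] <-]; rewrite setTI.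
have -> : (fun t : V => x - t) @^-1` [set y | y k = a] = [set t | t k = x k - a].
  apply/seteqP; split => t /=; rewrite vaddE voppE.
    by move=> <-; rewrite opprB addrC subrK.
  by move=> ->; rewrite opprB addrC subrK.
exact: measurable_coord.
Qed.

Variable mu : probability V R.
Hypothesis mu_haar : is_haar mu.

(** Uniqueness of measures on the pi-system of boxes: t |-> x - t permutes each
    factor, hence preserves the cardinals that determine the measure of a box. *)
Lemma haar_reflect (x : V) (S : set V) : measurable S ->
  mu ((fun t => x - t) @^-1` S) = mu S.
Proof.
move=> mS.
apply: (measure_unique boxes (fun=> setT) measurable_boxes boxesI _ _
  (pushforward mu (fun t => x - t)) mu) => //.
- move=> _; exists 0%N, (fun k => [set: _]%SET).
  by apply/seteqP; split.
- by apply/seteqP; split => // y _; exists 0%N.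
- exact: measurable_reflect.
- move=> mx _ [n [A ->]].
  transitivity (mu (box n (fun k => [set z | x k - z \in A k]%SET))).
    rewrite /pushforward; congr (mu _).
    apply/seteqP; split => t /= H k kn; have := H k kn; by rewrite inE.
  have muE A' : mu (box n A') = (\prod_(k < n) (#|A' k|%:R / (m k)%:R))%:E.
    exact: mu_haar.
  rewrite muE; apply: etrans (esym (muE A)).
  apply: congr1; apply: eq_bigr => k _; congr (_%:R / _).
  have rK : cancel (fun z => x k - z) (fun z => x k - z).
    by move=> z; rewrite opprB addrC subrK.
  rewrite -(card_imset (A k) (can_inj rK)); apply: eq_card => z.
  rewrite inE; apply/idP/imsetP => [H|[w wA ->]]; last by rewrite rK.
  by exists (x k - z); rewrite ?rK.
- move=> mx _; apply: (@le_lt_trans _ _ 1%E); last exact: ltry.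
  exact: (probability_le1 mu measurableT).
Qed.

Let mu2 := (mu \x mu)%E.

Lemma measurable_reflect2 (x y : V) :
  measurable_fun setT (fun z : V * V => (x - z.1, y - z.2)).
Proof.
apply: measurable_fun_pair.
  exact: (measurableT_comp (measurable_reflect x)).
exact: (measurableT_comp (measurable_reflect y)).
Qed.

Lemma haar2_reflect (x y : V) (S : set (V * V)) : measurable S ->
  mu2 ((fun z => (x - z.1, y - z.2)) @^-1` S) = mu2 S.
Proof.
move=> mS; rewrite [RHS](@product_measure_unique _ _ _ _ _ mu mu
  (pushforward mu2 (fun z : V * V => (x - z.1, y - z.2))))//.
  exact: measurable_reflect2.
move=> mxy A B mA mB.
transitivity (mu2 (((fun t => x - t) @^-1` A) `*` ((fun t => y - t) @^-1` B))).
  by [].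
have mpre (w : V) (C : set V) : measurable C ->
    measurable ((fun t => w - t) @^-1` C).
  by move=> mC; rewrite -[X in measurable X]setTI; exact: measurable_reflect.
apply: etrans (product_measure1E _ _ (mpre _ _ mA) (mpre _ _ mB)) _.
exact: (congr2 _ (haar_reflect x mA) (haar_reflect y mB)).
Qed.

Lemma haar2_setT : mu2 setT = 1%E.
Proof.
rewrite /mu2 -setXTT; apply: etrans (product_measure1E _ _ _ _) _ => //.
have muT := probability_setT mu.
by apply: etrans (congr2 _ muT muT) (mule1 _).
Qed.

End HaarInvariance.

Lemma sum_triangle (S : nmodType) (F : nat -> nat -> S) j :
  \sum_(0 <= q < j) \sum_(q <= k < j) F q k =
  \sum_(k < j) \sum_(q < k.+1) F q k.
Proof.
elim: j => [|j IH]; first by rewrite big_geq// big_ord0.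
rewrite big_ord_recr/= -IH big_nat_recr//= big_nat1.
rewrite big_ord_recr/= addrA; congr (_ + _).
rewrite -[X in _ = _ + X](big_mkord xpredT (fun q => F q j)) -big_split/=.
rewrite !big_nat; apply: eq_bigr => q /andP[_ qj].
by rewrite big_nat_recr// ltnW.
Qed.

(** * Weighted means and limits *)

Section WeightedMeans.
Variables (R : realType) (m : nat -> nat).
Hypothesis m_ge2 : forall k, (2 <= m k)%N.
Local Notation M := (Mprod m).

(** Since M grows geometrically, the indices below A0 have a fixed total weight,
    and all the others together weigh at most 2 M_N. *)
Lemma weighted_sum_le (w : nat -> R[i]) (e : R[i]) A0 : 0 <= e ->
  (forall A, (A0 <= A)%N -> `|w A| <= e) ->
  forall N, \sum_(A < N.+1) (M A)%:R * `|w A| <=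
    \sum_(A < A0) (M A)%:R * `|w A| + e * (2 * M N)%:R.
Proof.
move=> e0 we N; have pos i : 0 <= (M i)%:R * `|w i| by rewrite mulr_ge0.
apply: (@le_trans _ _ (\sum_(A < A0) (M A)%:R * `|w A| +
    e * \sum_(A < N.+1) (M A)%:R)); last first.
  by rewrite lerD// ler_wpM2l// -natr_sum ler_nat sum_Mprod_le.
have [AN|NA] := leqP A0 N.+1.
  rewrite -(subnKC AN) !big_split_ord/= lerD// mulrDr ler_wpDl//.
    by rewrite mulr_ge0// sumr_ge0.
  rewrite mulr_sumr; apply: ler_sum => i _.
  by rewrite mulrC ler_wpM2r// we// leq_addr.
rewrite ler_wpDr ?mulr_ge0 ?sumr_ge0// -(subnKC (ltnW NA)) big_split_ord/=.
by rewrite lerDl sumr_ge0.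
Qed.

Lemma complex_nat_bound (c : R[i]) : 0 <= c ->
  exists n0, forall n, (n0 <= n)%N -> c < n%:R.
Proof.
move=> c0; exists (Num.bound (complex.Re c)) => n n0n.
have cE : c = (complex.Re c)%:C by rewrite RRe_real// ger0_real.
have r0 : 0 <= complex.Re c by move: c0; rewrite cE ler0c.
rewrite cE -[n%:R](rmorph_nat (real_complex R)) ltcR.
rewrite (lt_le_trans (archi_boundP r0))// ler_nat//.
Qed.

End WeightedMeans.

(** * Convergence at Marcinkiewicz-Lebesgue points *)

Section PointwiseConvergence.
Variables (R : realType) (m : nat -> nat).
Hypothesis m_ge2 : forall k, (2 <= m k)%N.
Variable B : nat.
Hypothesis m_le : forall k, (m k <= B)%N.
Local Notation M := (Mprod m).
Local Notation V := (vilenkin m).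
Local Notation psi := (@psi m R).
Local Notation D := (@dirichlet R m).
Local Notation K := (@marcinkiewicz_sum R m).
Variable mu : probability V R.
Hypothesis mu_haar : is_haar mu.
Local Notation mu2 := (mu \x mu)%E.
Local Notation CI := (Cintegral mu2 setT).
Local Notation Cint := (Cintegrable mu2).
Implicit Types (g h : V * V -> R[i]) (p : V * V -> V).

(** Bounded measurable functions: they are integrable, and their products with
    integrable functions remain integrable.  All the kernels are of this kind. *)
Definition tame g := Cmeasurable g /\ exists c : R[i], forall z, `|g z| <= c.

Lemma tame_cst c : tame (fun=> c).
Proof. by split; [apply: Cmeasurable_cst|exists `|c|]. Qed.

Lemma tameD g h : tame g -> tame h -> tame (fun z => g z + h z).
Proof.
move=> [mg [c gc]] [mh [e he]]; split; first exact: CmeasurableD.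
by exists (c + e) => z; rewrite (le_trans (ler_normD _ _))// lerD.
Qed.

Lemma tameM g h : tame g -> tame h -> tame (fun z => g z * h z).
Proof.
move=> [mg [c gc]] [mh [e he]]; split; first exact: CmeasurableM.
by exists (c * e) => z; rewrite normrM ler_pM.
Qed.

Lemma tame_sum (I : Type) (s : seq I) (F : I -> V * V -> R[i]) :
  (forall i, tame (F i)) -> tame (fun z => \sum_(i <- s) F i z).
Proof.
move=> iF; elim: s => [|i s IH].
  by under eq_fun do rewrite big_nil; apply: tame_cst.
by under eq_fun do rewrite big_cons; apply: tameD.
Qed.

Lemma tame_prod (I : Type) (s : seq I) (F : I -> V * V -> R[i]) :
  (forall i, tame (F i)) -> tame (fun z => \prod_(i <- s) F i z).
Proof.
move=> iF; elim: s => [|i s IH].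
  by under eq_fun do rewrite big_nil; apply: tame_cst.
by under eq_fun do rewrite big_cons; apply: tameM.
Qed.

Lemma tame_norm g : tame g -> tame (fun z => `|g z|).
Proof.
move=> [mg [c gc]]; split; first exact: Cmeasurable_norm.
by exists c => z; rewrite normr_id.
Qed.

Lemma tame_comp (phi : V * V -> V * V) g : measurable_fun setT phi ->
  tame g -> tame (fun z => g (phi z)).
Proof.
by move=> mphi [mg [c gc]]; split; [exact: Cmeasurable_comp|exists c => z].
Qed.

Lemma tame_psi p n : measurable_fun setT p -> tame (fun z => psi n (p z)).
Proof.
move=> mp; split; last by exists 1 => z; rewrite norm_psi.
exact: (Cmeasurable_comp (f := psi n) mp (Cmeasurable_psi _ _ _)).
Qed.

Lemma tame_psi2 i j : tame (fun z => psi i z.1 * psi j z.2).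
Proof.
exact: tameM (tame_psi _ measurable_fst) (tame_psi _ measurable_snd).
Qed.

Lemma tame_Icyl p n c : measurable_fun setT p ->
  tame (fun z => \1_(Icyl n c) (p z)).
Proof.
move=> mp; split; last first.
  by exists 1 => z; rewrite indicE normr_nat; case: (_ \in _).
apply: (Cmeasurable_comp (f := \1_(Icyl n c)) mp).
exact: Cmeasurable_indic (measurable_Icyl _ _).
Qed.

Lemma tame_dirichlet2 k l : tame (fun z => D k z.1 * D l z.2).
Proof.
apply: tameM; apply: tame_sum => i.
  exact: (tame_psi _ measurable_fst).
exact: (tame_psi _ measurable_snd).
Qed.

Lemma tame_marcinkiewicz_sum n : tame (fun z => K n z.1 z.2).
Proof.
by apply: tame_sum => l; apply: tame_dirichlet2.
Qed.

Lemma tame_rprod i n : tame (fun z => rprod R i n z.1 z.2).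
Proof.
apply: tame_prod => l; apply: tame_sum => s.
have H := tame_psi2 (M l) (M l); under eq_fun do rewrite psiD//.
elim: (nat_of_ord s) => [|p IH].
  by under eq_fun do rewrite expr0; apply: tame_cst.
by under eq_fun do rewrite exprS; apply: tameM.
Qed.

Lemma Cintegrable_tame f g : Cint f -> tame g -> Cint (fun z => f z * g z).
Proof. by move=> fi [mg [c gc]]; apply: CintegrableMr gc. Qed.

Lemma haar2_lty : (mu2 setT < +oo)%E.
Proof. by rewrite haar2_setT// ltry. Qed.

Lemma tame_integrable g : tame g -> Cint g.
Proof.
move=> /(Cintegrable_tame (Cintegrable_cst 1 haar2_lty)).
by under eq_fun do rewrite mul1r.
Qed.

(** Orthogonality from invariance alone: with h (t, u) = psi_i (t) psi_j (u),
    reflecting at (x, y) and then at the origin gives int h = h (x, y) int h,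
    and some value of h is not 1 unless i = j = 0. *)
Lemma Cintegral_psi i j :
  CI (fun z => psi i z.1 * psi j z.2) = ((i == 0%N) && (j == 0%N))%:R.
Proof.
have [/andP[/eqP -> /eqP ->]|ij] := boolP ((i == 0%N) && (j == 0%N)).
  rewrite -(Cintegral_cst 1 (haar2_setT mu)); apply: eq_Cintegral => z.
  by rewrite !psi0 mulr1.
pose h (z : V * V) := psi i z.1 * psi j z.2.
have th : tame h by exact: tame_psi2.
have inv x y : CI h = CI (fun z => h (x - z.1, y - z.2)).
  rewrite (@Cintegral_comp _ _ _ _ (fun z : V * V => (x - z.1, y - z.2)) h) //.
  - exact: measurable_reflect2.
  - exact: haar2_reflect.
  - by case: th.
  - by apply: tame_integrable; apply: tame_comp => //; apply: measurable_reflect2.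
have mult x y : CI h = h (x, y) * CI h.
  rewrite {1}(inv x y) (inv 0 0) -CintegralZ; last first.
    by apply: tame_integrable; apply: tame_comp => //; apply: measurable_reflect2.
  apply: eq_Cintegral => z; rewrite /h/= !sub0r !psiD//.
  by ring.
have [x [y hxy]] : exists x y, h (x, y) != 1.
  case: (posnP i) => [i0|/(psi_neq1 R m_ge2)[x hx]].
    have /(psi_neq1 R m_ge2)[y hy] : (0 < j)%N.
      by move: ij; rewrite i0 eqxx/= lt0n.
    by exists 0, y; rewrite /h/= psi_at0// mul1r.
  by exists x, 0; rewrite /h/= psi_at0// mulr1.
have := mult x y; move/eqP; rewrite -subr_eq0 -{1}[CI h]mul1r -mulrBl mulf_eq0.
by rewrite subr_eq0 eq_sym (negbTE hxy)/= => /eqP.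
Qed.

Lemma Cintegral_dirichlet2 l : CI (fun z => D l z.1 * D l z.2) = (0 < l)%:R.
Proof.
rewrite (eq_Cintegral _ _ (g := fun z =>
  \sum_(i < l) \sum_(j < l) psi i z.1 * psi j z.2)); last first.
  by move=> z; rewrite /D mulr_suml; apply: eq_bigr => i _; rewrite mulr_sumr.
rewrite Cintegral_sum; last first.
  move=> i; apply: tame_integrable; apply: tame_sum => j.
  exact: tame_psi2.
under eq_bigr => i _.
  rewrite Cintegral_sum; last first.
    move=> j; apply: tame_integrable.
    exact: tame_psi2.
  under eq_bigr => j _ do rewrite Cintegral_psi.
  over.
case: l => [|l]; first by rewrite big_ord0.
rewrite big_ord_recl big_ord_recl/= !big1 ?addr0//.
Qed.

(** The kernel has mass n - 1 rather than n, because the term S_{0,0} of the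
    mean is an empty sum. *)
Lemma Cintegral_marcinkiewicz_sum n : CI (fun z => K n z.1 z.2) = n.-1%:R.
Proof.
rewrite Cintegral_sum; last first.
  move=> l; apply: tame_integrable.
  exact: tame_dirichlet2.
under eq_bigr => l _ do rewrite Cintegral_dirichlet2.
case: n => [|n]; first by rewrite big_ord0.
rewrite big_ord_recl/= add0r.
by under eq_bigr => l _ do rewrite /= ; rewrite sumr_const card_ord.
Qed.

Variable f : V * V -> R[i].
Hypothesis f_L1 : Cint f.

Lemma partial_sumE N L x y : partial_sum mu f N L x y =
  CI (fun z => f z * (D N (x - z.1) * D L (y - z.2))).
Proof.
have tp i j : tame (fun z => psi i (x - z.1) * psi j (y - z.2)).
  exact: (tame_comp (measurable_reflect2 x y) (tame_psi2 i j)).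
rewrite (eq_Cintegral _ _ (g := fun z => \sum_(i < N) \sum_(j < L)
    f z * (psi i (x - z.1) * psi j (y - z.2)))); last first.
  move=> z; rewrite /D mulr_suml mulr_sumr; apply: eq_bigr => i _.
  by rewrite !mulr_sumr.
rewrite Cintegral_sum; last first.
  by move=> i; apply: Cintegrable_sum => j; apply: Cintegrable_tame.
apply: eq_bigr => i _; rewrite Cintegral_sum; last first.
  by move=> j; apply: Cintegrable_tame.
apply: eq_bigr => j _; rewrite /fourier_coef -mulrA mulrC.
rewrite -CintegralZ.
  by apply: eq_Cintegral => z; rewrite !psiD// -!psi_conj//; ring.
rewrite (_ : (fun z => _) = fun z => f z * (psi i (- z.1) * psi j (- z.2)));
  last first.
  by apply/funext => z; rewrite -mulrA !(psi_conj _ m_ge2).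
apply: Cintegrable_tame => //.
have := tame_comp (measurable_reflect2 0 0) (tame_psi2 i j).
by under eq_fun do rewrite /= !sub0r.
Qed.

(** The sum of the square partial sums as a convolution, with the translation
    moved onto f as in the definition of Delta. *)
Lemma sum_partial_sumE n x y : \sum_(l < n) partial_sum mu f l l x y =
  CI (fun z => f (x - z.1, y - z.2) * K n z.1 z.2).
Proof.
have mphi := measurable_reflect2 x y.
have inv := haar2_reflect mu_haar x y.
have tK := tame_comp mphi (tame_marcinkiewicz_sum n).
have tD l : tame (fun z => D l (x - z.1) * D l (y - z.2)).
  exact: (tame_comp mphi (tame_dirichlet2 l l)).
under eq_bigr => l _ do rewrite partial_sumE.
rewrite -Cintegral_sum; last by move=> l; apply: Cintegrable_tame.
pose h z := f (x - z.1, y - z.2) * K n z.1 z.2.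
have hE z : h (x - z.1, y - z.2) = f z * K n (x - z.1) (y - z.2).
  by rewrite /h/= !opprB !(addrC _ (_ - _)) !subrK; case: z.
rewrite -(@Cintegral_comp _ _ _ _ _ h mphi inv).
- by apply: eq_Cintegral => z; rewrite hE /K mulr_sumr.
- apply: CmeasurableM; last by case: (tame_marcinkiewicz_sum n).
  exact: (Cmeasurable_comp mphi (Cintegrable_measurable f_L1)).
- by under eq_fun do rewrite hE; apply: Cintegrable_tame.
Qed.

Variables x y : V.
Local Notation Dlt z := (Delta f x y z.1 z.2).
(** Integration against Delta as a linear functional of the kernel, so that W
    and the bound on the means can be compared through their kernels. *)
Definition Delta_int g : R[i] := CI (fun z => Dlt z * g z).

Lemma Cintegrable_shifted :
  Cint (fun z => f (x - z.1, y - z.2) - f (x, y)).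
Proof.
have mphi := measurable_reflect2 x y.
have inv := haar2_reflect mu_haar x y.
apply: CintegrableD; first exact: (Cintegrable_comp mphi inv f_L1).
exact: (Cintegrable_cst _ haar2_lty).
Qed.

Lemma Cintegrable_Delta : Cint (fun z => Dlt z).
Proof. exact: Cintegrable_norm Cintegrable_shifted. Qed.

Lemma Cintegrable_Delta_tame g : tame g -> Cint (fun z => Dlt z * g z).
Proof. exact: Cintegrable_tame Cintegrable_Delta. Qed.

Lemma Delta_intD g h : tame g -> tame h ->
  Delta_int (fun z => g z + h z) = Delta_int g + Delta_int h.
Proof.
move=> tg th; rewrite /Delta_int -CintegralD; try exact: Cintegrable_Delta_tame.
by apply: eq_Cintegral => z; rewrite mulrDr.
Qed.

Lemma Delta_intZ c g : tame g -> Delta_int (fun z => c * g z) = c * Delta_int g.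
Proof.
move=> tg; rewrite /Delta_int -CintegralZ; try exact: Cintegrable_Delta_tame.
by apply: eq_Cintegral => z; rewrite mulrCA.
Qed.

Lemma Delta_int_sum (I : Type) (s : seq I) (F : I -> V * V -> R[i]) :
  (forall i, tame (F i)) ->
  Delta_int (fun z => \sum_(i <- s) F i z) = \sum_(i <- s) Delta_int (F i).
Proof.
move=> tF; rewrite /Delta_int -Cintegral_sum.
  by apply: eq_Cintegral => z; rewrite mulr_sumr.
by move=> i; apply: Cintegrable_Delta_tame.
Qed.

Lemma eq_Delta_int g h : g =1 h -> Delta_int g = Delta_int h.
Proof. by move=> /funext ->. Qed.

(** As the kernel has mass n - 1, subtracting (n - 1) f (x, y) replaces
    f (x - t, y - u) by f (x - t, y - u) - f (x, y) under the integral. *)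
Lemma norm_sum_partial_sum_le n :
  `|\sum_(l < n) partial_sum mu f l l x y - n.-1%:R * f (x, y)| <=
  2 * Delta_int (fun z => `|K n z.1 z.2|).
Proof.
have tK := tame_marcinkiewicz_sum n.
have fi := Cintegrable_tame Cintegrable_shifted tK.
rewrite sum_partial_sumE -Cintegral_marcinkiewicz_sum mulrC.
rewrite -CintegralZ; last exact: tame_integrable.
have -> : CI (fun z => f (x - z.1, y - z.2) * K n z.1 z.2) =
    CI (fun z => (f (x - z.1, y - z.2) - f (x, y)) * K n z.1 z.2) +
    CI (fun z => f (x, y) * K n z.1 z.2).
  rewrite -CintegralD//.
    by apply: eq_Cintegral => z; ring.
  exact/CintegrableZ/tame_integrable.
rewrite addrK (le_trans (norm_Cintegral_le fi))// ler_wpM2l//.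
rewrite le_eqVlt; apply/orP; left; apply/eqP/eq_Cintegral => z.
by rewrite normrM.
Qed.

Lemma tame_fejer_majorant p k : measurable_fun setT p ->
  tame (fun z => fejer_majorant R k (p z)).
Proof.
move=> mp; apply: tame_sum => s; apply: tameM (tame_cst _) _.
by apply: tame_sum => a; apply: tame_Icyl.
Qed.

(** Stated for a measurable coordinate map p so as to cover both variables. *)
Lemma Delta_int_fejer_majorant p h k : measurable_fun setT p -> tame h ->
  Delta_int (fun z => h z * fejer_majorant R k (p z)) =
  \sum_(q < k.+1) (M q)%:R * \sum_(1 <= a < m q)
     Delta_int (fun z => h z * \1_(Icyl k (mul_e m a q)) (p z)).
Proof.
move=> mp th.
have tha q a : tame (fun z => h z * \1_(Icyl k (mul_e m a q)) (p z)).
  by apply: tameM => //; apply: tame_Icyl.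
transitivity (Delta_int (fun z => \sum_(q < k.+1) (M q)%:R * \sum_(1 <= a < m q)
     h z * \1_(Icyl k (mul_e m a q)) (p z))).
  apply: eq_Delta_int => z; rewrite mulr_sumr; apply: eq_bigr => q _.
  by rewrite mulrCA; congr (_ * _); rewrite /spike mulr_sumr.
rewrite Delta_int_sum => [|q]; last first.
  by apply: tameM (tame_cst _) _; apply: tame_sum.
apply: eq_bigr => q _; rewrite Delta_intZ; last exact: tame_sum.
by rewrite Delta_int_sum.
Qed.

Lemma tame_cross_majorant j i :
  tame (fun z => cross_majorant R j i z.1 z.2).
Proof.
apply: tameD; apply: tameM.
- exact: (tame_Icyl _ _ measurable_fst).
- exact: (tame_fejer_majorant _ measurable_snd).
- exact: (tame_fejer_majorant _ measurable_fst).
- exact: (tame_Icyl _ _ measurable_snd).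
Qed.

Lemma tame_block_term k j :
  tame (fun z => cross_majorant R k k z.1 z.2 * rprod R k.+1 j z.1 z.2).
Proof. exact: tameM (tame_cross_majorant _ _) (tame_rprod _ _). Qed.

Lemma tame_block_majorant j : tame (fun z => block_majorant R j z.1 z.2).
Proof.
apply: tame_sum => k; under eq_fun do rewrite -mulrA.
exact: tameM (tame_cst _) (tame_block_term _ _).
Qed.

Lemma tame_W_kernel j : tame (fun z => W_kernel R j z.1 z.2).
Proof.
apply: tameD (tame_block_majorant j) _; apply: tameM (tame_cst _) _.
by apply: tame_sum => i; apply: tameM (tame_cst _) (tame_cross_majorant _ _).
Qed.

Lemma Cintegral_box (A A' : set V) g :
  Cintegral mu2 (A `*` A') (fun z => Dlt z * g z) =
  Delta_int (fun z => \1_A z.1 * g z * \1_A' z.2).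
Proof.
rewrite Cintegral_mkcond; apply: eq_Cintegral => z.
have -> : \1_(A `*` A') z = \1_A z.1 * \1_A' z.2 :> R[i].
  rewrite !indicE in_setX -natrM mulnb//.
ring.
Qed.

(** The definition of W, with its sums over q <= k reordered so that the inner
    one is a fejer_majorant. *)
Lemma Delta_int_W_kernel j :
  Delta_int (fun z => W_kernel R j z.1 z.2) = (M j)%:R * Wmean mu f j x y.
Proof.
have M0 : (M j)%:R != 0 :> R[i] by rewrite pnatr_eq0 -lt0n Mprod_gt0.
rewrite /Wmean !mulrDr !mulrA !divff// !mul1r !sum_triangle.
rewrite Delta_intD; [|exact: tame_block_majorant|]; last first.
  apply: tameM (tame_cst _) _.
  by apply: tame_sum => i; apply: tameM (tame_cst _) (tame_cross_majorant _ _).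
rewrite -addrA; congr (_ + _).
  rewrite Delta_int_sum; last first.
    move=> k; under eq_fun do rewrite -mulrA.
    exact: tameM (tame_cst _) (tame_block_term _ _).
  rewrite -big_split/=; apply: eq_bigr => k _.
  under eq_Delta_int do rewrite -mulrA.
  rewrite Delta_intZ; last exact: tame_block_term.
  have t1 : tame (fun z => \1_(Icyl k 0) z.1 * rprod R k.+1 j.-1 z.1 z.2).
    exact: tameM (tame_Icyl _ _ measurable_fst) (tame_rprod _ _).
  have t2 : tame (fun z => \1_(Icyl k 0) z.2 * rprod R k.+1 j.-1 z.1 z.2).
    exact: tameM (tame_Icyl _ _ measurable_snd) (tame_rprod _ _).
  transitivity ((M k)%:R ^+ 2 * (
     Delta_int (fun z => (\1_(Icyl k 0) z.1 * rprod R k.+1 j.-1 z.1 z.2)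
                         * fejer_majorant R k z.2)
   + Delta_int (fun z => (\1_(Icyl k 0) z.2 * rprod R k.+1 j.-1 z.1 z.2)
                         * fejer_majorant R k z.1))).
    congr (_ * _); rewrite -Delta_intD.
    - by apply: eq_Delta_int => z; rewrite /cross_majorant; ring.
    - exact: tameM t1 (tame_fejer_majorant _ measurable_snd).
    - exact: tameM t2 (tame_fejer_majorant _ measurable_fst).
  rewrite (Delta_int_fejer_majorant _ measurable_snd t1).
  rewrite (Delta_int_fejer_majorant _ measurable_fst t2).
  rewrite mulrDr !mulr_sumr; congr (_ + _).
    apply: eq_bigr => q _; rewrite mulrA mulr_sumr; apply: eq_bigr => a _.
    by rewrite Cintegral_box [(M q)%:R * _]mulrC.
  apply: eq_bigr => q _; rewrite mulrA mulr_sumr; apply: eq_bigr => a _.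
  rewrite Cintegral_box [(M q)%:R * _]mulrC; congr (_ * _).
  by apply: eq_Delta_int => z; ring.
rewrite Delta_intZ; last first.
  by apply: tame_sum => i; apply: tameM (tame_cst _) (tame_cross_majorant _ _).
rewrite -mulrDr; congr (_ * _).
rewrite Delta_int_sum; last first.
  by move=> i; apply: tameM (tame_cst _) (tame_cross_majorant _ _).
rewrite -big_split/=; apply: eq_bigr => i _.
rewrite Delta_intZ; last exact: tame_cross_majorant.
transitivity ((M i)%:R * (
     Delta_int (fun z => \1_(Icyl j 0) z.1 * fejer_majorant R i z.2)
   + Delta_int (fun z => \1_(Icyl j 0) z.2 * fejer_majorant R i z.1))).
  congr (_ * _); rewrite -Delta_intD.
  - by apply: eq_Delta_int => z; rewrite /cross_majorant; ring.
  - exact: tameM (tame_Icyl _ _ measurable_fst) (tame_fejer_majorant _ measurable_snd).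
  - exact: tameM (tame_Icyl _ _ measurable_snd) (tame_fejer_majorant _ measurable_fst).
have box1 (A A' : set V) : Cintegral mu2 (A `*` A') (fun z => Dlt z) =
    Delta_int (fun z => \1_A z.1 * \1_A' z.2).
  transitivity (Cintegral mu2 (A `*` A') (fun z => Dlt z * 1)).
    by apply: eq_Cintegral => z; rewrite mulr1.
  by rewrite Cintegral_box; apply: eq_Delta_int => z; rewrite mulr1.
rewrite (Delta_int_fejer_majorant _ measurable_snd (tame_Icyl _ _ measurable_fst)).
rewrite (Delta_int_fejer_majorant _ measurable_fst (tame_Icyl _ _ measurable_snd)).
rewrite mulrDr !mulr_sumr; congr (_ + _).
  apply: eq_bigr => q _; rewrite mulrA [(M i)%:R * _]mulrC; congr (_ * _).
  by apply: eq_bigr => a _; rewrite box1.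
apply: eq_bigr => q _; rewrite mulrA [(M i)%:R * _]mulrC; congr (_ * _).
apply: eq_bigr => a _; rewrite box1.
by apply: eq_Delta_int => z; rewrite mulrC.
Qed.

Lemma le_Delta_int g h : tame g -> tame h ->
  (forall z, g z <= h z) -> Delta_int g <= Delta_int h.
Proof.
move=> tg th gh; apply: le_Cintegral; try exact: Cintegrable_Delta_tame.
by move=> z; rewrite ler_wpM2l ?normr_ge0.
Qed.

Lemma norm_sum_partial_sum_le_Wmean n N : (n < M N)%N ->
  `|\sum_(l < n) partial_sum mu f l l x y - n.-1%:R * f (x, y)| <=
  (6 * B ^ 4)%:R * \sum_(A < N) (M A)%:R * `|Wmean mu f A x y|.
Proof.
move=> nN; rewrite (le_trans (norm_sum_partial_sum_le n))//.
rewrite (_ : 6 = 2 * 3)%N// -mulnA natrM -mulrA ler_wpM2l//.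
have tS : tame (fun z => \sum_(A < N) W_kernel R A z.1 z.2).
  by apply: tame_sum => A; apply: tame_W_kernel.
have tK : tame (fun z => `|K n z.1 z.2|).
  by apply: tame_norm; apply: tame_marcinkiewicz_sum.
have tC := tameM (tame_cst (3 * B ^ 4)%:R) tS.
apply: le_trans (le_Delta_int tK tC _) _.
  by move=> z; apply: norm_marcinkiewicz_sum_le.
rewrite Delta_intZ// ler_wpM2l// Delta_int_sum; last first.
  by move=> A; apply: tame_W_kernel.
apply: ler_sum => A _; rewrite Delta_int_W_kernel ler_wpM2l//.
rewrite real_ler_norm// ger0_real//.
have M0 : 0 < (M A)%:R :> R[i] by rewrite ltr0n Mprod_gt0.
rewrite -(pmulr_rge0 _ M0) -Delta_int_W_kernel; apply: Cintegral_ge0 => z.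
rewrite mulr_ge0 ?normr_ge0// /W_kernel addr_ge0 ?block_majorant_ge0 ?mulr_ge0//.
by apply: sumr_ge0 => i _; rewrite mulr_ge0 ?cross_majorant_ge0.
Qed.

Hypothesis xy_ML : marcinkiewicz_lebesgue_point mu f x y.

(** With M_N <= n < M_{N+1}, the error is at most a constant times
    (1/n) sum_{A <= N} M_A W_A, plus |f (x, y)| / n from the missing unit of
    mass.  Choosing W_A <= d = e / (4 C) for A >= A0, the large indices
    contribute at most 2 C d M_N / n <= e / 2, and what remains is a fixed
    quantity divided by n. *)
Lemma marcinkiewicz_fejer_cvg :
  (fun n : nat => marcinkiewicz_fejer mu f n x y : R[i]^o) @ \oo
    --> (f (x, y) : R[i]^o).
Proof.
apply/cvgrPdist_lt => e e0.
pose C : R[i] := (6 * B ^ 4)%:R.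
have C0 : 0 < C.
  by rewrite ltr0n muln_gt0/= expn_gt0 (ltn_trans _ (B_ge2 m_ge2 m_le)).
(* the factor 4 pays for the halving of e and for sum_{A <= N} M_A <= 2 M_N *)
pose d := e / (4 * C).
have d0 : 0 < d by rewrite divr_gt0// mulr_gt0.
have /cvgr0Pnorm_lt/(_ _ d0)[A0 _ HA] := xy_ML.
have wd A : (A0 <= A)%N -> `|Wmean mu f A x y| <= d.
  by move=> AA; rewrite ltW//; exact: HA.
have wsum := weighted_sum_le m_ge2 (ltW d0) wd.
set S := \sum_(A < A0) _ in wsum.
have S0 : 0 <= S by apply: sumr_ge0 => A _; rewrite mulr_ge0.
have c0 : 0 <= (C * S + `|f (x, y)|) * (2 / e).
  have [C1 e1] := (ltW C0, ltW e0).
  by rewrite mulr_ge0 ?addr_ge0 ?mulr_ge0 ?invr_ge0.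
have [n0 Hn0] := complex_nat_bound c0.
exists n0.+1 => // n /= n0n.
have npos : (0 < n)%N by exact: leq_trans n0n.
have nR : 0 < n%:R :> R[i] by rewrite ltr0n.
have [N Nn nN] := Mprod_bracket m_ge2 npos.
rewrite distrC /marcinkiewicz_fejer.
set T := \sum_(j < n) _.
have -> : n%:R^-1 * T - f (x, y) =
    n%:R^-1 * ((T - n.-1%:R * f (x, y)) - f (x, y)).
  have -> : n.-1%:R = n%:R - 1 :> R[i].
    by rewrite -[in RHS](prednK npos) -natr1 addrK.
  by field; rewrite gt_eqF.
rewrite normrM normfV normr_nat mulrC ltr_pdivrMr//.
apply: (le_lt_trans (ler_normB _ _)).
apply: (@le_lt_trans _ _ (C * (S + d * (2 * M N)%:R) + `|f (x, y)|)).
  rewrite lerD//; apply: le_trans (norm_sum_partial_sum_le_Wmean nN) _.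
  by rewrite ler_wpM2l// ltW.
rewrite mulrDr addrAC (_ : e * n%:R = e / 2 * n%:R + e / 2 * n%:R); last first.
  by rewrite -mulrDl -splitr.
rewrite ltr_leD//.
  have := Hn0 n (ltnW n0n); rewrite mulrA ltr_pdivrMr// mulrC => H.
  rewrite -(ltr_pM2l (ltr0n _ 2)) mulrA mulrCA divff ?mulr1 ?pnatr_eq0//.
  by rewrite [e * _]mulrC.
have -> : C * (d * (2 * M N)%:R) = e / 2 * (M N)%:R.
  rewrite natrM /d; field.
  by rewrite pnatr_eq0 -lt0n (ltn_trans _ (B_ge2 m_ge2 m_le)).
by rewrite ler_wpM2l ?ler_nat// divr_ge0// ltW.
Qed.

End PointwiseConvergence.

Unset Implicit Arguments.
Set Strict Implicit.
Set Printing Implicit Defensive.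

Theorem theorem1 (R : realType) (m : nat -> nat)
    (m_ge2 : forall k : nat, (2 <= m k)%N)
    (m_bounded : exists B : nat, forall k : nat, (m k <= B)%N)
    (mu : probability (vilenkin m) R) (mu_haar : is_haar mu)
    (f : vilenkin m * vilenkin m -> R[i])
    (f_L1 : Cintegrable (mu \x mu)%E f)
    (x y : vilenkin m)
    (xy_ML : marcinkiewicz_lebesgue_point mu f x y) :
  (fun n : nat => marcinkiewicz_fejer mu f n x y : R[i]^o) @ \oo
    --> (f (x, y) : R[i]^o).
Proof.
have [B m_le] := m_bounded.
exact: (marcinkiewicz_fejer_cvg m_ge2 m_le mu_haar f_L1 xy_ML).
Qed.
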